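(* The transitive closure of an $n$-vertex directed graph can be computed in the $(m,\ell)$-TCU model in time $$T(n)=\Theta\!\left(\frac{n^3}{\sqrt{m}}+\frac{n^2}{m}\ell+n^2\sqrt{m}\right).$$ In particular, when $n\geq m$ this is $\Theta\!\left(\frac{n^3}{\sqrt{m}}+\frac{n^2}{m}\ell\right)$.
   Context: The transitive closure of an $n$-vertex directed graph $G$ is the $n\times n$ $0/1$ matrix $c$ with $c[i,j]=1$ iff vertex $j$ is reachable from vertex $i$; the graph is given by its $n\times n$ $0/1$ adjacency matrix. The $(m,\ell)$-TCU model (parameters $m\ge 1$, $\ell\ge 0$) is the standard RAM model whose CPU additionally contains a tensor unit: by a constant-size instruction specifying the memory addresses of the operands and of the output, the unit multiplies an $N\times\sqrt{m}$ matrix by a $\sqrt{m}\times\sqrt{m}$ matrix (where $N\geq\sqrt{m}$ is chosen by the algorithm) and writes the product to memory, at a cost of $O(N\sqrt{m}+\ell)$ time. The running time of an algorithm is the total cost of all operations performed, including all calls to the tensor unit. *)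

(* Defs.v *)
From HB Require Import structures.
From mathcomp Require Import all_boot all_order all_algebra.

Set Implicit Arguments.
Unset Strict Implicit.
Unset Printing Implicit Defensive.

Definition digraph (n : nat) := rel 'I_n.

Definition adjacency_mx n (G : digraph n) : 'M[bool]_n :=
  \matrix_(i, j) G i j.

(* [connect] is reflexive: every vertex is reachable from itself. *)
Definition transitive_closure n (G : digraph n) : 'M[bool]_n :=
  \matrix_(i, j) connect G i j.

Definition word_mx r c (A : 'M[bool]_(r, c)) : 'M[nat]_(r, c) :=
  map_mx nat_of_bool A.

Definition memory := nat -> nat.

Definition upd (f : nat -> nat) (a v : nat) : nat -> nat :=
  fun x => if x == a then v else f x.

(* Matrices are stored contiguously in row-major order. *)
Definition read_mx (M : memory) (a r c : nat) : 'M[nat]_(r, c) :=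
  \matrix_(i < r, j < c) M (a + (i * c + j)).

Definition write_mx r c (M : memory) (a : nat) (A : 'M[nat]_(r, c)) : memory :=
  fun x =>
    if a <= x then
      match (insub ((x - a) %/ c) : option 'I_r),
            (insub ((x - a) %% c) : option 'I_c) with
      | Some i, Some j => A i j
      | _, _ => M x
      end
    else M x.

Variant binop := Add | Sub | Mul | Div.

(* Words are natural numbers: Sub is truncated at 0, and x / 0 = 0. *)
Definition eval_binop (o : binop) (x y : nat) : nat :=
  match o with
  | Add => x + y
  | Sub => x - y
  | Mul => x * y
  | Div => x %/ y
  end.

(* Arguments are register numbers, except [v] in [Const] (an immediate value)
   and the jump targets [p].  [LoadW r a] and [StoreW a r] address the memory
   indirectly through register [a].  In [Tensor a b c N] the registers hold the
   addresses of the left operand, the right operand and the output, and the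
   number of rows of the left operand. *)
Variant instr :=
  | Const of nat & nat
  | Op of binop & nat & nat & nat
  | LoadW of nat & nat
  | StoreW of nat & nat
  | Jump of nat
  | JumpZ of nat & nat
  | Tensor of nat & nat & nat & nat
  | Halt.

Definition program := seq instr.

Record state := State { pc : nat; regs : nat -> nat; mem : memory }.

(* The (m, l)-TCU with m = s ^ 2 and words of w bits.  [step] returns the cost
   of the current instruction and the next state; it is undefined when the
   machine has halted, when the program counter leaves the program, when a
   result does not fit in a word, and on an illegal use of the tensor unit
   (fewer than s rows, or an operand beyond the addressable memory). *)
Section Machine.
Variables (w s l : nat) (P : program).

Definition set_reg (st : state) (r v : nat) : option (nat * state) :=
  if v < 2 ^ w then Some (1, State (pc st).+1 (upd (regs st) r v) (mem st))
  else None.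

Definition tensor_step (st : state) (a b c N : nat) : option (nat * state) :=
  let C := (read_mx (mem st) a N s *m read_mx (mem st) b s s)%R in
  if [&& s <= N, a + N * s <= 2 ^ w, b + s * s <= 2 ^ w, c + N * s <= 2 ^ w
       & [forall i, forall j, C i j < 2 ^ w]]
  then Some (N * s + l, State (pc st).+1 (regs st) (write_mx (mem st) c C))
  else None.

Definition step (st : state) : option (nat * state) :=
  let R := regs st in
  match nth Halt P (pc st) with
  | Const r v => set_reg st r v
  | Op o r x y => set_reg st r (eval_binop o (R x) (R y))
  | LoadW r a => set_reg st r (mem st (R a))
  | StoreW a r => Some (1, State (pc st).+1 R (upd (mem st) (R a) (R r)))
  | Jump p => Some (1, State p R (mem st))
  | JumpZ r p =>
      Some (1, State (if R r == 0 then p else (pc st).+1) R (mem st))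
  | Tensor a b c N => tensor_step st (R a) (R b) (R c) (R N)
  | Halt => None
  end.

Definition halted (st : state) : Prop := onth P (pc st) = Some Halt.

Inductive run : state -> nat -> state -> Prop :=
  | run_halt st : halted st -> run st 1 st
  | run_step st c st1 t st2 :
      step st = Some (c, st1) -> run st1 t st2 -> run st (c + t) st2.

(* Registers 0, 1, 2 hold n, sqrt m and l; the adjacency matrix is stored from
   address 0 on; everything else is 0. *)
Definition init n (G : digraph n) : state :=
  State 0 (nth 0 [:: n; s; l])
    (write_mx (fun=> 0) 0 (word_mx (adjacency_mx G))).

Definition computes_transitive_closure (n : nat) : Prop :=
  forall G : digraph n, exists t st,
    run (init G) t st /\
    read_mx (mem st) 0 n n = word_mx (transitive_closure G).

Definition worst_case_time (n T : nat) : Prop :=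
  (forall (G : digraph n) t st, run (init G) t st -> t <= T) /\
  (exists (G : digraph n) st, run (init G) T st).

End Machine.

(* T = Theta(f) uniformly in the triples (n, sqrt m, l) satisfying D. *)
Definition Theta_on (D : nat -> nat -> nat -> Prop)
    (T : nat -> nat -> nat -> nat) (f : nat -> nat -> nat -> rat) : Prop :=
  exists c1 c2 : rat, [/\ (0 < c1)%R, (0 < c2)%R &
    forall n s l, D n s l ->
      (c1 * f n s l <= (T n s l)%:R)%R /\ ((T n s l)%:R <= c2 * f n s l)%R].

(* Main.v *)
Require Import Defs.
From mathcomp Require Import all_boot all_order all_algebra.
From mathcomp Require Import zify ring lra.

Set Implicit Arguments.
Unset Strict Implicit.
Unset Printing Implicit Defensive.

(** Blocked Warshall algorithm.  The vertices are cut into q = ceil(n / s) blocks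
    of h = min(n, s) vertices (the last one overlaps its predecessor instead of
    being padded).  For each block K, Warshall's pivots in K are first applied to
    the rows of K only, which costs O(h^2 n); then every other row i is completed
    at once by D[i, j] |= OR_(a in K) D[i, a] D[a, j], an n x s by s x n product
    done with q calls to the tensor unit.  The invariant is that D is transitive
    through every processed pivot.  Summing over the q blocks gives
    n^2 s + (n / s)^2 (n s + l).

    If n < s, a single block finishes the job and the tensor unit is not used.
    The resulting O(n^3) time can be far below the claimed bound, so the program
    then idles for n^2 s + n^2 l / s^2 iterations.

    No branch depends on the graph, hence the running time is a function of
    (n, s, l) alone. *)

(** * A structured language compiled to TCU programs *)

(** [worst_case_time] asks for a maximum over all graphs that is attained, so costs are tracked as
    equalities: every command carries an exact cost, one closed formula [total_cost] results, and
    determinism of the machine makes it the worst case. Only then are the two inequalities of the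
    Theta bound derived from it. Boolean algebra is simulated on words: a disjunction is a sum
    clamped to 1, and an entry of the integer matrix product counts middle vertices, hence is at
    most s and fits in a word. For n < s the tensor unit has to be avoided because a left operand
    with n rows is then illegal. The overlap of the last block is harmless because transitivity
    through a set of pivots is preserved when some of them are processed again. Invariants are
    stated as transitivity, not as existence of paths; paths appear only when the final relation is
    compared with [connect]. *)

Inductive expr :=
  | Var of nat
  | Cst of nat
  | Bin of binop & expr & expr
  | Ld of expr.

Inductive cmd :=
  | Skip
  | Assign of nat & expr
  | Store of expr & expr
  | Mult of nat & nat & nat & nat
  | Seq of cmd & cmd
  | When of nat & cmd
  | For of nat & nat & cmd.

(* Registers from [tmp 0] on hold intermediate values of expressions; program
   variables are registers below [tmp 0]. *)
Definition tmp (d : nat) := 20 + d.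

(** The machine has no register move: a copy is an addition to a register just set to 0, hence two
    instructions per variable. The depth [d] acts as a stack pointer. *)
Fixpoint compile_expr (e : expr) (d : nat) : seq instr :=
  match e with
  | Var x => [:: Const (tmp d) 0; Op Add (tmp d) x (tmp d)]
  | Cst v => [:: Const (tmp d) v]
  | Bin o e1 e2 => compile_expr e1 d ++ compile_expr e2 d.+1
                   ++ [:: Op o (tmp d) (tmp d) (tmp d.+1)]
  | Ld e => compile_expr e d ++ [:: LoadW (tmp d) (tmp d)]
  end.

(** Doubles as a running time: the code of an expression has no jump and each of its instructions
    costs 1. *)
Fixpoint expr_size (e : expr) : nat :=
  match e with
  | Var _ => 2
  | Cst _ => 1
  | Bin _ e1 e2 => expr_size e1 + (expr_size e2 + 1)
  | Ld e => expr_size e + 1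
  end.

Fixpoint cmd_size (c : cmd) : nat :=
  match c with
  | Skip => 0
  | Assign _ e => expr_size e + 2
  | Store ea ev => expr_size ea + (expr_size ev + 1)
  | Mult _ _ _ _ => 1
  | Seq c1 c2 => cmd_size c1 + cmd_size c2
  | When _ c => 1 + cmd_size c
  | For _ _ c => 3 + (cmd_size c + 3)
  end.

(** Jump targets are absolute, hence the offset [off]. A loop is left when the truncated difference
    of bound and counter is 0; the back jump goes to this test at [off.+1], past the initialisation
    of the counter. *)
Fixpoint compile (c : cmd) (off : nat) : seq instr :=
  match c with
  | Skip => [::]
  | Assign x e => compile_expr e 0
                  ++ [:: Const (tmp 1) 0; Op Add x (tmp 0) (tmp 1)]
  | Store ea ev => compile_expr ea 0 ++ compile_expr ev 1
                   ++ [:: StoreW (tmp 0) (tmp 1)]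
  | Mult a b c N => [:: Tensor a b c N]
  | Seq c1 c2 => compile c1 off ++ compile c2 (off + cmd_size c1)
  | When x c => JumpZ x (off + (1 + cmd_size c)) :: compile c off.+1
  | For x y c =>
      [:: Const x 0; Op Defs.Sub (tmp 0) y x;
          JumpZ (tmp 0) (off + (3 + (cmd_size c + 3)))]
      ++ compile c (off + 3)
      ++ [:: Const (tmp 0) 1; Op Add x x (tmp 0); Jump off.+1]
  end.

Lemma size_compile_expr e d : size (compile_expr e d) = expr_size e.
Proof.
elim: e d => //= [o e1 IH1 e2 IH2 d|e IH d]; first by rewrite !size_cat IH1 IH2.
by rewrite size_cat IH.
Qed.

Lemma size_compile c off : size (compile c off) = cmd_size c.
Proof.
elim: c off => //=.
- by move=> x e off; rewrite size_cat size_compile_expr.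
- by move=> ea ev off; rewrite !size_cat !size_compile_expr.
- by move=> c1 IH1 c2 IH2 off; rewrite size_cat IH1 IH2.
- by move=> x c IH off; rewrite IH.
- by move=> x y c IH off; rewrite size_cat IH.
Qed.

Fixpoint expr_wf (e : expr) : bool :=
  match e with
  | Var x => x < tmp 0
  | Cst _ => true
  | Bin _ e1 e2 => expr_wf e1 && expr_wf e2
  | Ld e => expr_wf e
  end.

Fixpoint cmd_wf (c : cmd) : bool :=
  match c with
  | Skip => true
  | Assign x e => (x < tmp 0) && expr_wf e
  | Store ea ev => expr_wf ea && expr_wf ev
  | Mult a b c N => [&& a < tmp 0, b < tmp 0, c < tmp 0 & N < tmp 0]
  | Seq c1 c2 => cmd_wf c1 && cmd_wf c2
  | When x c => (x < tmp 0) && cmd_wf c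
  | For x y c => [&& x < tmp 0, y < tmp 0 & cmd_wf c]
  end.

Fixpoint writes (c : cmd) : seq nat :=
  match c with
  | Skip | Store _ _ | Mult _ _ _ _ => [::]
  | Assign x _ => [:: x]
  | Seq c1 c2 => writes c1 ++ writes c2
  | When _ c => writes c
  | For x _ c => x :: writes c
  end.

Definition code_at (P : program) (off : nat) (code : seq instr) : Prop :=
  forall i, i < size code -> nth Halt P (off + i) = nth Halt code i.

Lemma code_at_cat P off c1 c2 :
  code_at P off (c1 ++ c2) <->
  code_at P off c1 /\ code_at P (off + size c1) c2.
Proof.
split=> [H|[H1 H2] i].
  split=> i ilt; last first.
    by rewrite -addnA H ?size_cat ?ltn_add2l // nth_cat ltnNge leq_addr addKn.
  by rewrite H ?size_cat ?nth_cat ?ilt // (leq_trans ilt) ?leq_addr.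
rewrite size_cat nth_cat; case: (ltnP i (size c1)) => [ilt _|le ilt]; first exact: H1.
by rewrite -{1}(subnKC le) addnA H2 // ltn_subLR.
Qed.

Lemma code_at_cons P off i c :
  code_at P off (i :: c) -> nth Halt P off = i /\ code_at P off.+1 c.
Proof.
move=> H; split; first by have := H 0 isT; rewrite addn0.
by move=> j jlt; rewrite addSnnS (H j.+1).
Qed.

Lemma upd_same f a v : upd f a v a = v.
Proof. by rewrite /upd eqxx. Qed.

Lemma upd_neq f a v x : x != a -> upd f a v x = f x.
Proof. by rewrite /upd => /negPf ->. Qed.

(** * Semantics with exact costs, and correctness of the compiler *)

Section Execution.
Variables (w s l : nat).
Local Notation env := (nat -> nat).

(** Unlike [run], this execution may stop anywhere, so that compiled fragments compose. *)
Inductive steps (P : program) : state -> nat -> state -> Prop :=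
  | steps_refl st : steps P st 0 st
  | steps_step st c st1 t st2 :
      step w s l P st = Some (c, st1) -> steps P st1 t st2 ->
      steps P st (c + t) st2.

Lemma steps_trans P st1 t1 st2 t2 st3 :
  steps P st1 t1 st2 -> steps P st2 t2 st3 -> steps P st1 (t1 + t2) st3.
Proof.
elim=> // st c st4 t st5 Hs _ IH H.
by rewrite -addnA; apply: steps_step Hs (IH H).
Qed.

Lemma steps1 P st c st' : step w s l P st = Some (c, st') -> steps P st c st'.
Proof. by move=> H; rewrite -[c]addn0; apply: steps_step H (steps_refl _ _). Qed.

Fixpoint eval (r : env) (M : memory) (e : expr) : nat :=
  match e with
  | Var x => r x
  | Cst v => v
  | Bin o e1 e2 => eval_binop o (eval r M e1) (eval r M e2)
  | Ld e => M (eval r M e)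
  end.

(** [step] is undefined on overflow, so all intermediate values must fit in a word, not just the
    result. *)
Fixpoint fits (r : env) (M : memory) (e : expr) : bool :=
  (eval r M e < 2 ^ w) &&
  match e with
  | Bin _ e1 e2 => fits r M e1 && fits r M e2
  | Ld e => fits r M e
  | _ => true
  end.

Definition mult_ok (M : memory) (a b c N : nat) : bool :=
  [&& s <= N, a + N * s <= 2 ^ w, b + s * s <= 2 ^ w, c + N * s <= 2 ^ w
    & [forall i, forall j,
        (read_mx M a N s *m read_mx M b s s)%R i j < 2 ^ w]].

(* The cost is exact, and all iterations of a loop must have the same cost. *)
Inductive exec : cmd -> env -> memory -> nat -> env -> memory -> Prop :=
  | exec_skip r M : exec Skip r M 0 r M
  | exec_assign x e r M :
      fits r M e ->
      exec (Assign x e) r M (expr_size e + 2) (upd r x (eval r M e)) M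
  | exec_store ea ev r M :
      fits r M ea -> fits r M ev ->
      exec (Store ea ev) r M (expr_size ea + (expr_size ev + 1))
        r (upd M (eval r M ea) (eval r M ev))
  | exec_mult a b c N r M :
      mult_ok M (r a) (r b) (r c) (r N) ->
      exec (Mult a b c N) r M (r N * s + l) r
        (write_mx M (r c) (read_mx M (r a) (r N) s *m read_mx M (r b) s s)%R)
  | exec_seq c1 c2 r M t1 r1 M1 t2 r2 M2 :
      exec c1 r M t1 r1 M1 -> exec c2 r1 M1 t2 r2 M2 ->
      exec (Seq c1 c2) r M (t1 + t2) r2 M2
  | exec_when0 x c r M : r x = 0 -> exec (When x c) r M 1 r M
  | exec_when1 x c r M t r' M' :
      r x != 0 -> exec c r M t r' M' -> exec (When x c) r M (1 + t) r' M'
  | exec_for x y c t N (rs : nat -> env) (Ms : nat -> memory) :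
      x \notin writes c -> y \notin x :: writes c ->
      rs 0 y = N -> N < 2 ^ w -> 1 < 2 ^ w ->
      (forall i, i < N ->
         exec c (upd (rs i) x i) (Ms i) t (rs i.+1) (Ms i.+1)) ->
      exec (For x y c) (rs 0) (Ms 0) (3 + N * (t + 5))
        (upd (rs N) x N) (Ms N).

(** Lets the counter and the bound of a loop survive its body. *)
Lemma exec_frame c r M t r' M' z :
  exec c r M t r' M' -> z \notin writes c -> r' z = r z.
Proof.
move=> H; elim: H z => {c r M t r' M'} //=.
- by move=> x e r M _ z; rewrite inE /upd => /negPf ->.
- move=> c1 c2 r M t1 r1 M1 t2 r2 M2 _ IH1 _ IH2 z.
  by rewrite mem_cat negb_or => /andP[/IH1 <- /IH2].
- move=> x y c t N rs Ms xc yc rN N_lt w_gt _ IH z zc.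
  have IH' i : i <= N -> rs i z = rs 0 z.
    elim: i => // i IHi ilt; rewrite IH //; last first.
      by move: zc; rewrite inE negb_or => /andP[].
    rewrite /upd IHi ?(ltnW ilt) //.
    by move: zc; rewrite inE negb_or => /andP[/negPf ->].
  rewrite /upd IH' //.
  by move: zc; rewrite inE negb_or => /andP[/negPf ->].
Qed.

Definition represents (R r : env) := forall x, x < tmp 0 -> R x = r x.

Lemma represents_tmp R r d v : represents R r -> represents (upd R (tmp d) v) r.
Proof.
move=> H x xlt; rewrite /upd; case: eqP => [e|_]; last exact: H.
by move: xlt; rewrite e /tmp; lia.
Qed.

Lemma represents_upd R r x v :
  represents R r -> represents (upd R x v) (upd r x v).
Proof. by move=> H y ylt; rewrite /upd; case: eqP => // _; apply: H. Qed.

Lemma eval_lt r M e : fits r M e -> eval r M e < 2 ^ w.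
Proof. by case: e => [x|v|o e1 e2|e] /andP[]. Qed.

Lemma pow_gt0 : 0 < 2 ^ w.
Proof. by rewrite expn_gt0. Qed.

(** The last clause carries the induction: evaluating a right operand at depth [d.+1] must not
    disturb the left operand kept in [tmp d]. *)
Lemma compile_expr_correct P e d off R r M :
  code_at P off (compile_expr e d) -> expr_wf e -> represents R r ->
  fits r M e ->
  exists R', [/\ steps P (State off R M) (expr_size e)
                   (State (off + expr_size e) R' M),
                 represents R' r, R' (tmp d) = eval r M e
               & forall x, x < tmp d -> R' x = R x].
Proof.
elim: e d off R => /=.
- move=> x d off R /code_at_cons[c1 /code_at_cons[c2 _]] xlt rep /andP[xw _].
  exists (upd (upd R (tmp d) 0) (tmp d) (r x)); split.
  + apply: (@steps_step _ _ 1 (State off.+1 (upd R (tmp d) 0) M)).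
      by rewrite /step /= c1 /set_reg /= pow_gt0.
    apply: steps1; rewrite /step /= c2 /set_reg /= upd_same addn0.
    have -> : upd R (tmp d) 0 x = r x.
      rewrite /upd; case: eqP => [e|_]; last exact: rep.
      by move: xlt; rewrite e /tmp; lia.
    by rewrite xw addn2.
  + by do 2!apply: represents_tmp.
  + by rewrite /upd eqxx.
  + by move=> y ylt; rewrite /upd; case: eqP => // e; lia.
- move=> v d off R /code_at_cons[c1 _] _ rep /andP[vw _].
  exists (upd R (tmp d) v); split.
  + by apply: steps1; rewrite /step /= c1 /set_reg /= vw addn1.
  + exact: represents_tmp.
  + by rewrite /upd eqxx.
  + by move=> y ylt; rewrite /upd; case: eqP => // e; lia.
- move=> o e1 IH1 e2 IH2 d off R /code_at_cat[c1 /code_at_cat[c2]].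
  rewrite !size_compile_expr in c2 *.
  move=> /code_at_cons[c3 _] /andP[wf1 wf2] rep /and3P[ow f1 f2].
  have [R1 [s1 rep1 v1 pres1]] := IH1 _ _ _ c1 wf1 rep f1.
  have [R2 [s2 rep2 v2 pres2]] := IH2 _ _ _ c2 wf2 rep1 f2.
  exists (upd R2 (tmp d) (eval_binop o (eval r M e1) (eval r M e2))); split.
  + apply: steps_trans s1 _; apply: steps_trans s2 _; apply: steps1.
    rewrite /step /= c3 /set_reg /= v2 pres2 ?v1 ?ow; last by rewrite /tmp; lia.
    by rewrite !addnA addn1.
  + exact: represents_tmp.
  + by rewrite /upd eqxx.
  + move=> y ylt; rewrite /upd; case: eqP => [e|_]; first by lia.
    by rewrite pres2 ?pres1 //; move: ylt; rewrite /tmp; lia.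
- move=> e IH d off R /code_at_cat[c1].
  rewrite size_compile_expr => /code_at_cons[c2 _] wf rep /andP[vw f].
  have [R1 [s1 rep1 v1 pres1]] := IH _ _ _ c1 wf rep f.
  exists (upd R1 (tmp d) (M (eval r M e))); split.
  + apply: steps_trans s1 _; apply: steps1.
    by rewrite /step /= c2 /set_reg /= v1 vw addnA addn1.
  + exact: represents_tmp.
  + by rewrite /upd eqxx.
  + move=> y ylt; rewrite /upd; case: eqP => [e'|_]; first by lia.
    exact: pres1.
Qed.

Lemma compile_correct P c off R r M t r' M' :
  exec c r M t r' M' -> code_at P off (compile c off) -> cmd_wf c ->
  represents R r ->
  exists R', steps P (State off R M) t (State (off + cmd_size c) R' M') /\
             represents R' r'.
Proof.
move=> H; elim: H off R => {c r M t r' M'} /=.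
- by move=> r M off R _ _ rep; exists R; rewrite addn0; split=> //; apply: steps_refl.
- move=> x e r M f off R /code_at_cat[c1]; rewrite size_compile_expr.
  move=> /code_at_cons[c2 /code_at_cons[c3 _]] /andP[_ wf] rep.
  have [R1 [s1 rep1 v1 _]] := compile_expr_correct c1 wf rep f.
  exists (upd (upd R1 (tmp 1) 0) x (eval r M e)); split.
    apply: steps_trans s1 _.
    apply: (@steps_step _ _ 1 (State (off + expr_size e).+1 (upd R1 (tmp 1) 0) M)).
      by rewrite /step /= c2 /set_reg /= pow_gt0.
    apply: steps1; rewrite /step /= c3 /set_reg /=.
    by rewrite upd_same upd_neq // v1 addn0 eval_lt // addnA addn2.
  exact/represents_upd/represents_tmp.
- move=> ea ev r M fa fv off R /code_at_cat[c1 /code_at_cat[c2]].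
  rewrite !size_compile_expr in c2 *.
  move=> /code_at_cons[c3 _] /andP[wfa wfv] rep.
  have [R1 [s1 rep1 v1 _]] := compile_expr_correct c1 wfa rep fa.
  have [R2 [s2 rep2 v2 pres]] := compile_expr_correct c2 wfv rep1 fv.
  exists R2; split=> //.
  apply: steps_trans s1 _; apply: steps_trans s2 _; apply: steps1.
  by rewrite /step /= c3 /= v2 pres // v1 !addnA addn1.
- move=> a b c N r M ok off R /code_at_cons[c1 _] /and4P[wa wb wc wN] rep.
  exists R; split=> //; apply: steps1; rewrite /step /= c1 !rep //.
  by rewrite /tensor_step /=; move: ok; rewrite /mult_ok => ->; rewrite addn1.
- move=> c1 c2 r M t1 r1 M1 t2 r2 M2 _ IH1 _ IH2 off R /code_at_cat[d1].
  rewrite size_compile => d2 /andP[wf1 wf2] rep.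
  have [R1 [s1 rep1]] := IH1 _ _ d1 wf1 rep.
  have [R2 [s2 rep2]] := IH2 _ _ d2 wf2 rep1.
  by exists R2; split=> //; rewrite addnA; apply: steps_trans s1 s2.
- move=> x c r M x0 off R /code_at_cons[c1 _] /andP[wx _] rep.
  by exists R; split=> //; apply: steps1; rewrite /step /= c1 rep // x0.
- move=> x c r M t r' M' x0 _ IH off R /code_at_cons[c1 c2] /andP[wx wf] rep.
  have [R1 [s1 rep1]] := IH _ _ c2 wf rep.
  exists R1; split=> //; apply: (@steps_step _ _ 1 (State off.+1 R M)).
    by rewrite /step /= c1 rep // (negPf x0).
  by rewrite addnA addn1.
- move=> x y c t N rs Ms xc yc rN N_lt w_gt ex IH off R.
  move=> /code_at_cons[c1 /code_at_cons[c2 /code_at_cons[c3]]].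
  rewrite -[off.+3]addn3 => /code_at_cat[c4]; rewrite size_compile.
  move=> /code_at_cons[c5 /code_at_cons[c6 /code_at_cons[c7 _]]].
  move=> /and3P[wx wy wf] rep.
  have xy : (y == x) = false.
    by move: yc; rewrite inE negb_or => /andP[/negPf].
  have yN i : i <= N -> rs i y = N.
    elim: i => // i IHi ilt.
    rewrite (exec_frame (ex i ilt)) /upd ?xy ?IHi ?(ltnW ilt) //.
    by move: yc; rewrite inE negb_or => /andP[].
  (* The case [i = N] is included, so this serves both the tests that enter the body and the one
     that leaves the loop. *)
  have test i Ri : i <= N -> represents Ri (upd (rs i) x i) ->
      steps P (State off.+1 Ri (Ms i)) 2
        (State (if N - i == 0 then off + (3 + (cmd_size c + 3)) else off + 3)
           (upd Ri (tmp 0) (N - i)) (Ms i)).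
    move=> ile repi.
    have Ry : Ri y = N by rewrite repi // /upd xy yN.
    have Rx : Ri x = i by rewrite repi // /upd eqxx.
    apply: (@steps_step _ _ 1 (State off.+2 (upd Ri (tmp 0) (N - i)) (Ms i))).
      rewrite /step /= c2 /set_reg /= Ry Rx.
      by rewrite (leq_ltn_trans (leq_subr _ _) N_lt).
    by apply: steps1; rewrite /step /= c3 upd_same (addn3 off).
  (* One instruction sets the counter; each iteration adds two for the test, [t] for the body and
     three for the increment and the back jump. The failing test accounts for the remaining two
     units of [3 + N * (t + 5)]. *)
  have head i : i <= N -> exists Ri,
      steps P (State off R (Ms 0)) (1 + i * (t + 5)) (State off.+1 Ri (Ms i)) /\
      represents Ri (upd (rs i) x i).
    elim: i => [_|i IHi ilt].
      exists (upd R x 0); split; last exact: represents_upd.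
      by apply: steps1; rewrite /step /= c1 /set_reg /= pow_gt0.
    have [Ri [si repi]] := IHi (ltnW ilt).
    have := test i Ri (ltnW ilt) repi; rewrite subn_eq0 leqNgt ilt /= => s2.
    have [R2 [s3 rep2]] := IH i ilt _ _ c4 wf (represents_tmp 0 (N - i) repi).
    have R2x : R2 x = i.
      by rewrite rep2 // (exec_frame (ex i ilt)) // /upd eqxx.
    exists (upd (upd R2 (tmp 0) 1) x i.+1); split; last first.
      exact/represents_upd/represents_tmp.
    have -> : 1 + i.+1 * (t + 5) = (1 + i * (t + 5)) + (2 + (t + (1 + (1 + 1)))).
      by lia.
    apply: steps_trans si _; apply: steps_trans s2 _; apply: steps_trans s3 _.
    apply: (@steps_step _ _ 1 (State (off + 3 + cmd_size c).+1 (upd R2 (tmp 0) 1) (Ms i.+1))).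
      by rewrite /step /= c5 /set_reg /= w_gt.
    apply: (@steps_step _ _ 1 (State (off + 3 + cmd_size c).+2
              (upd (upd R2 (tmp 0) 1) x i.+1) (Ms i.+1))).
      rewrite /step /= c6 /set_reg /=.
      have -> : upd R2 (tmp 0) 1 x = i.
        by rewrite /upd; case: eqP => // e; move: wx; rewrite e ltnn.
      by rewrite upd_same addn1 (leq_ltn_trans ilt N_lt).
    by apply: steps1; rewrite /step /= c7.
  have [RN [sN repN]] := head N (leqnn N).
  exists (upd RN (tmp 0) 0); split; last exact: represents_tmp.
  have := test N RN (leqnn N) repN; rewrite subnn /= => s2.
  have -> : 3 + N * (t + 5) = (1 + N * (t + 5)) + 2 by lia.
  exact: steps_trans sN s2.
Qed.

End Execution.

(** * Complete runs and determinism *)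

Lemma run_steps w s l P st t st' :
  steps w s l P st t st' -> halted P st' -> run w s l P st (t + 1) st'.
Proof.
elim=> [st1 h|st1 c st2 t1 st3 Hs _ IH h]; first exact: run_halt.
by rewrite -addnA; apply: run_step Hs (IH h).
Qed.

Lemma halted_step w s l P st : halted P st -> step w s l P st = None.
Proof.
by rewrite /step => /(onth_nth Halt) ->.
Qed.

(** Turns the cost of one exhibited run into a bound on all runs, as [worst_case_time] requires. *)
Lemma run_det w s l P st t1 st1 t2 st2 :
  run w s l P st t1 st1 -> run w s l P st t2 st2 -> t1 = t2 /\ st1 = st2.
Proof.
move=> H; elim: H t2 st2 => {st t1 st1}.
  move=> st h t2 st2 H; case: H h => // st1 c st3 t st4 Hs _ h.
  by rewrite halted_step in Hs.
move=> st c st1 t st3 Hs _ IH t2 st2 H.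
case: H Hs IH => [st4 h|st4 c' st5 t' st6 Hs' H'] Hs IH.
  by rewrite halted_step in Hs.
move: Hs'; rewrite Hs => -[<- e]; rewrite -e in H'.
by have [-> ->] := IH _ _ H'.
Qed.

(** * Loop rules: invariants and filling of arrays *)

Section Rules.
Variables (w s l : nat).
Hypothesis w_gt0 : 1 < 2 ^ w.
Local Notation env := (nat -> nat).
Local Notation exec := (exec w s l).
Local Notation fits := (fits w).

Definition agree (xs : seq nat) (r r' : env) :=
  forall z, z \notin xs -> r' z = r z.

Lemma exec_agree c r M t r' M' : exec c r M t r' M' -> agree (writes c) r r'.
Proof. by move=> H z; apply: exec_frame H. Qed.

Lemma agree_trans xs r1 r2 r3 :
  agree xs r1 r2 -> agree xs r2 r3 -> agree xs r1 r3.
Proof. by move=> H1 H2 z zxs; rewrite H2 ?H1. Qed.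

Lemma agree_upd (xs : seq nat) r r' x v :
  x \in xs -> agree xs r r' -> agree xs r (upd r' x v).
Proof.
move=> xxs H z zxs; rewrite upd_neq ?H //.
by apply: contraNneq zxs => ->.
Qed.

(** [exec_for] wants whole sequences of environments and memories; they are built here by recursion
    on the number of iterations, from a body specified only up to an invariant. The invariant sees
    the memory alone, since [agree] already controls the registers. *)
Lemma for_rule (x y : nat) c t N (I : nat -> memory -> Prop) (r : env) M :
  x \notin writes c -> y \notin x :: writes c -> r y = N -> N < 2 ^ w ->
  I 0 M ->
  (forall i r' M', i < N -> r' x = i -> agree (x :: writes c) r r' -> I i M' ->
     exists r'' M'', exec c r' M' t r'' M'' /\ I i.+1 M'') ->
  exists r' M', [/\ exec (For x y c) r M (3 + N * (t + 5)) r' M',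
                    agree (x :: writes c) r r' & I N M'].
Proof.
move=> xc yc ryN N_lt I0 step.
have [rs [Ms [rs0 Ms0 ex IN]]] : exists rs Ms, [/\ rs 0 = r, Ms 0 = M,
    (forall i, i < N ->
       exec c (upd (rs i) x i) (Ms i) t (rs i.+1) (Ms i.+1)) & I N (Ms N)].
  have : N <= N by [].
  elim: {-2}N => [_|k IH klt].
    by exists (fun=> r), (fun=> M).
  have [rs [Ms [rs0 Ms0 ex Ik]]] := IH (ltnW klt).
  have rsk i : i <= k -> agree (x :: writes c) r (rs i).
    elim: i => [|i IHi] ik; first by rewrite rs0.
    apply: agree_trans (IHi (ltnW ik)) _ => z zx.
    rewrite (exec_frame (ex i ik)); last by move: zx; rewrite inE negb_or => /andP[].
    by rewrite upd_neq //; move: zx; rewrite inE negb_or => /andP[].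
  have [r'' [M'' [ex'' Ik']]] :=
    step k _ _ klt (upd_same _ _ _)
      (agree_upd _ (mem_head _ _) (rsk k (leqnn k))) Ik.
  exists (fun i => if i == k.+1 then r'' else rs i),
         (fun i => if i == k.+1 then M'' else Ms i); split=> //; last by rewrite eqxx.
  move=> i; rewrite ltnS eqSS => ik.
  rewrite (ltn_eqF (ik : i < k.+1)).
  by case: eqP ik => [->|/eqP ik' ik] //; apply: ex; rewrite ltn_neqAle ik'.
have H : exec (For x y c) r M (3 + N * (t + 5)) (upd (rs N) x N) (Ms N).
  by rewrite -rs0 -Ms0; apply: exec_for; rewrite ?rs0.
by exists (upd (rs N) x N), (Ms N); split=> //; apply: exec_agree H.
Qed.

(* The memories met while [M] is being overwritten with the values [F] at the
   addresses [a]. *)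
Definition partially_filled (N : nat) (a F : nat -> nat) (M M' : memory) :=
  forall z, M' z = M z \/ exists i, [/\ i < N, z = a i & M' z = F i].

Definition filled (N : nat) (a F : nat -> nat) (M M' : memory) :=
  (forall i, i < N -> M' (a i) = F i) /\
  (forall z, (forall i, i < N -> z != a i) -> M' z = M z).

Definition store_cost ea ev := expr_size ea + (expr_size ev + 1).

(** The stored value may depend on cells that the loop itself overwrites. The premise therefore
    offers only that each cell is old or final, plus one certainty due to injectivity of [a]: the
    target cell is still old. This is what allows updates in place. *)
Lemma fill_rule (x y : nat) ea ev N a F (r : env) M :
  y != x -> r y = N -> N < 2 ^ w ->
  (forall i j, i < N -> j < N -> a i = a j -> i = j) ->
  (forall i r' M', i < N -> r' x = i -> agree [:: x] r r' ->
     partially_filled N a F M M' -> M' (a i) = M (a i) ->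
     [/\ fits r' M' ea, fits r' M' ev, eval r' M' ea = a i
       & eval r' M' ev = F i]) ->
  exists r' M', [/\ exec (For x y (Store ea ev)) r M
                      (3 + N * (store_cost ea ev + 5)) r' M',
                    agree [:: x] r r' & filled N a F M M'].
Proof.
move=> yx ryN N_lt a_inj step.
pose I k (M' : memory) := (forall i, i < k -> M' (a i) = F i) /\
  (forall z, (forall i, i < k -> z != a i) -> M' z = M z).
apply: (@for_rule x y (Store ea ev) _ N I) => //; first by rewrite inE.
move=> i r' M' iN r'x agr [I1 I2].
have pf : partially_filled N a F M M'.
  move=> z; case: (boolP [exists j : 'I_i, z == a j]).
    case/existsP=> j /eqP zj; right; exists j; split=> //.
      exact: ltn_trans (ltn_ord j) iN.
    by rewrite zj I1.
  rewrite negb_exists => /forallP H; left; apply: I2 => j ji.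
  exact: (H (Ordinal ji)).
have ai : M' (a i) = M (a i).
  apply: I2 => j ji; apply/eqP => /(a_inj _ _ iN (ltn_trans ji iN)) e.
  by rewrite e ltnn in ji.
have [fa fv va vv] := step i r' M' iN r'x agr pf ai.
exists r', (upd M' (a i) (F i)); split.
  by rewrite -va -vv; apply: exec_store.
split=> [j|z H].
  rewrite ltnS leq_eqVlt => /orP[/eqP->|ji]; first by rewrite upd_same.
  rewrite upd_neq ?I1 //; apply/eqP => /(a_inj _ _ (ltn_trans ji iN) iN) e.
  by rewrite e ltnn in ji.
rewrite upd_neq ?H // I2 // => j ji.
by apply: H; apply: ltnW.
Qed.

Definition partially_filled2 (N N' : nat) (a F : nat -> nat -> nat)
    (M M' : memory) :=
  forall z, M' z = M z \/
    exists i j, [/\ i < N, j < N', z = a i j & M' z = F i j].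

Definition filled2 (N N' : nat) (a F : nat -> nat -> nat) (M M' : memory) :=
  (forall i j, i < N -> j < N' -> M' (a i j) = F i j) /\
  (forall z, (forall i j, i < N -> j < N' -> z != a i j) -> M' z = M z).

Definition fill2_cost ea ev N N' :=
  3 + N * (3 + N' * (store_cost ea ev + 5) + 5).

Lemma fill2_rule (x y u v : nat) ea ev N N' a F (r : env) M :
  [&& x != u, u != y, v != x & v != u] && (y != x) ->
  r y = N -> r v = N' -> N < 2 ^ w -> N' < 2 ^ w ->
  (forall i j i' j', i < N -> j < N' -> i' < N -> j' < N' ->
     a i j = a i' j' -> i = i' /\ j = j') ->
  (forall i j r' M', i < N -> j < N' -> r' x = i -> r' u = j ->
     agree [:: x; u] r r' ->
     partially_filled2 N N' a F M M' -> M' (a i j) = M (a i j) ->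
     [/\ fits r' M' ea, fits r' M' ev, eval r' M' ea = a i j
       & eval r' M' ev = F i j]) ->
  exists r' M', [/\ exec (For x y (For u v (Store ea ev))) r M
                      (fill2_cost ea ev N N') r' M',
                    agree [:: x; u] r r' & filled2 N N' a F M M'].
Proof.
move=> /andP[/and4P[xu uy vx vu] yx] ryN rvN N_lt N'_lt a_inj step.
apply: (@for_rule x y (For u v (Store ea ev)) _ N (fun k => filled2 k N' a F M)).
- by rewrite /= inE.
- by rewrite /= !inE negb_or yx eq_sym.
- by [].
- by [].
- by split.
move=> i r' M' iN r'x /= agr [I1 I2].
have a_fresh j : j < N' -> M' (a i j) = M (a i j).
  move=> jN; apply: I2 => i' j' i'i j'N; apply/eqP.
  move=> /(a_inj _ _ _ _ iN jN (ltn_trans i'i iN) j'N)[e _].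
  by rewrite e ltnn in i'i.
have [|||r'' [M'' [ex agr'' [F1 F2]]]] :=
  @fill_rule u v ea ev N' (a i) (F i) r' M' vu _ N'_lt.
- by rewrite agr // !inE negb_or vx.
- by move=> j j' jN j'N /a_inj[].
- move=> j r1 M1 jN r1u agr1 pf fresh; apply: step => //.
  + by rewrite agr1 ?inE.
  + move=> z zxu; rewrite agr1 ?agr //; move: zxu.
    by rewrite !inE !negb_or => /andP[].
  (* A cell untouched by the current row is final or old according to whether some earlier row
     contains it. *)
  + move=> z; case: (pf z) => [->|[j' [j'N -> ->]]]; last by right; exists i, j'.
    case: (boolP [exists i' : 'I_i, [exists j' : 'I_N', z == a i' j']]).
      case/existsP=> i' /existsP[j' /eqP ->]; right; exists i', j'; split=> //.
        exact: ltn_trans (ltn_ord i') iN.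
      exact: I1.
    rewrite negb_exists => /forallP H; left; apply: I2 => i' j' i'i j'N.
    have := H (Ordinal i'i); rewrite negb_exists => /forallP H'.
    exact: (H' (Ordinal j'N)).
  + by rewrite fresh a_fresh.
exists r'', M''; split=> //; split=> [i' j|z H].
  rewrite ltnS leq_eqVlt => /orP[/eqP->|i'i] jN; first exact: F1.
  rewrite F2 ?I1 // => j' j'N; apply/eqP.
  move=> /(a_inj _ _ _ _ (ltn_trans i'i iN) jN iN j'N)[e _].
  by rewrite e ltnn in i'i.
rewrite F2 => [|j jN]; last exact: H.
by apply: I2 => i' j i'i jN; apply: H => //; apply: ltnW.
Qed.

End Rules.

(** * Transitivity through pivots *)

Section Closure.
Variables (n : nat) (D0 R : rel nat).

Definition subrel_lt (D E : rel nat) :=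
  forall i j, i < n -> j < n -> D i j -> E i j.

(** Replaces Warshall's usual invariant on paths with intermediate vertices in [S]; when [S] holds
    everywhere below [n], it is plain transitivity. *)
Definition pivoted (S : pred nat) (D : rel nat) :=
  forall i k j, i < n -> k < n -> j < n -> S k -> D i k -> D k j -> D i j.

(* Invariant of the block loop, once the pivots in [S] have been processed. *)
Definition closure_inv (S : pred nat) (D : rel nat) :=
  [/\ pivoted S D, subrel_lt D0 D & subrel_lt D R].

Hypothesis R_trans : forall i k j, i < n -> k < n -> j < n ->
  R i k -> R k j -> R i j.

Section Block.
Variables (S : pred nat) (D : rel nat) (p h : nat).
Hypothesis p_h : p + h <= n.

Definition in_block (i : nat) := p <= i < p + h.

(* State of the matrix once rows [p, p + h) have been processed with the first
   [a] pivots of the block; the other rows still are those of [D]. *)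
Definition panel_inv (a : nat) (E : rel nat) :=
  [/\ forall i j, i < n -> j < n -> ~~ in_block i -> E i j = D i j,
      forall i k j, i < n -> k < n -> j < n -> in_block i ->
        S k || (p <= k < p + a) -> E i k -> E k j -> E i j,
      subrel_lt D0 E & subrel_lt E R].

Definition panel_pivot (a : nat) (E : rel nat) : rel nat := fun i j =>
  if in_block i then E i j || E i (p + a) && E (p + a) j else E i j.

Lemma panel_start : closure_inv S D -> panel_inv 0 D.
Proof.
case=> piv sub sound; split=> // i k j ilt klt jlt _.
by rewrite addn0 ltnNge andbN orbF; apply: piv.
Qed.

(** Pivoting at q = [p + a] changes neither row q nor column q, so transitivity through q is
    immediate. For an older pivot k, every new edge factors through q; since row q lies in the block
    too, the old transitivity removes k and leaves a path of length two through q. *)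
Lemma panel_step a E :
  a < h -> panel_inv a E -> panel_inv a.+1 (panel_pivot a E).
Proof.
move=> ah [out piv sub sound]; set E' := panel_pivot a E.
have qn : p + a < n by lia.
have qK : in_block (p + a) by rewrite /in_block; lia.
have incl i j : E i j -> E' i j.
  by rewrite /E' /panel_pivot => ->; case: in_block.
have new i j : in_block i -> E i (p + a) -> E (p + a) j -> E' i j.
  by rewrite /E' /panel_pivot => -> -> ->; rewrite orbT.
have E'P i j : E' i j -> E i j \/ [/\ in_block i, E i (p + a) & E (p + a) j].
  rewrite /E' /panel_pivot; case: (in_block i); last by left.
  by case/orP=> [|/andP[]]; [left|right].
split.
- by move=> i j ilt jlt iK; rewrite /E' /panel_pivot (negPf iK) out.
- move=> i k j ilt klt jlt iK kS.
  have [kq|kq] := eqVneq k (p + a).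
    rewrite kq => /E'P[e1|[_ e1 _]] /E'P[e2|[_ _ e2]]; exact: new.
  have {}kS : S k || (p <= k < p + a) by lia.
  move=> /E'P[e1|[_ e1 e1']] /E'P[e2|[kK e2 e2']].
  + exact/incl/(piv i k j).
  + by apply: new => //; apply: (piv i k).
  + by apply: new => //; apply: (piv _ k).
  + exact: new.
- by move=> i j ilt jlt /(sub _ _ ilt jlt); apply: incl.
- move=> i j ilt jlt /E'P[|[_ e1 e2]]; first exact: sound.
  by apply: (@R_trans i (p + a) j) => //; apply: sound.
Qed.

Definition block_product (E : rel nat) : rel nat := fun i j =>
  [exists a : 'I_h, E i (p + a) && E (p + a) j].

Definition block_update (E : rel nat) : rel nat := fun i j =>
  E i j || block_product E i j.

Lemma block_productP (E : rel nat) i j :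
  reflect (exists k, [/\ in_block k, E i k & E k j]) (block_product E i j).
Proof.
apply: (iffP existsP) => [[a /andP[e1 e2]]|[k [kK e1 e2]]].
  by exists (p + a); split=> //; rewrite /in_block; have := ltn_ord a; lia.
have kh : k - p < h by move: kK; rewrite /in_block; lia.
exists (Ordinal kh) => /=; rewrite subnKC ?e1 //.
by move: kK; rewrite /in_block; lia.
Qed.

(** Rows of the block are already transitive through its pivots. Hence the update can run over all
    rows without exception, and the rows that serve as right operand stay constant meanwhile. *)
Lemma panel_block_update E i j : panel_inv h E -> i < n -> j < n ->
  in_block i -> block_update E i j = E i j.
Proof.
case=> _ piv _ _ ilt jlt iK; apply/idP/idP; rewrite /block_update; last by move->.
case/orP=> // /block_productP[k [kK e1 e2]]; apply: (piv i k) => //.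
  by move: kK; rewrite /in_block; lia.
by move: kK; rewrite /in_block => ->; rewrite orbT.
Qed.

(** Block rows are transitive through [S] and the block by the panel invariant. Any other row is
    still a row of [D], hence transitive through a pivot of [S] whose own row is also unchanged;
    this is why [pivS] excludes pivots inside the block, which [pivK] and [new] handle. *)
Lemma block_update_closure E : closure_inv S D -> panel_inv h E ->
  closure_inv (fun k => S k || in_block k) (block_update E).
Proof.
move=> [pivD _ _] HE; have [out piv sub sound] := HE.
have Kn k : in_block k -> k < n by rewrite /in_block; lia.
have pivK i k j : in_block i -> in_block k -> j < n -> E i k -> E k j -> E i j.
  move=> iK kK jlt; apply: piv => //; try exact: Kn.
  by move: kK; rewrite /in_block => ->; rewrite orbT.
have pivS i k j : i < n -> k < n -> j < n -> S k -> ~~ in_block k ->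
    E i k -> E k j -> E i j.
  move=> ilt klt jlt kS kK; case: (boolP (in_block i)) => iK.
    by apply: piv; rewrite ?kS.
  by rewrite !out //; apply: pivD.
have updP i j : block_update E i j ->
    E i j \/ exists k, [/\ in_block k, E i k & E k j].
  by case/orP=> [|/block_productP]; [left|right].
have new i k j : in_block k -> E i k -> E k j -> block_update E i j.
  by move=> kK e1 e2; apply/orP; right; apply/block_productP; exists k.
split.
- move=> i k j ilt klt jlt.
  case: (boolP (in_block k)) => [kK _|kK]; last rewrite orbF.
    move=> + ekj; rewrite (panel_block_update HE) // in ekj.
    case/updP=> [e|[a [aK e1 e2]]]; first exact: new e ekj.
    by apply: (new _ a) => //; apply: (pivK _ k).
  (* New edges are paths of length two through the block. In the longest case, i to a to k to b to
     j, [pivS] removes k, [pivK] removes b, and the edge through a is an edge of the update. *)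
  move=> kS /updP[e1|[a [aK e1 e1']]] /updP[e2|[b [bK e2 e2']]].
  + by apply/orP; left; apply: (pivS i k).
  + by apply: (new _ b) => //; apply: (pivS _ k) => //; apply: Kn.
  + by apply: (new _ a) => //; apply: (pivS _ k) => //; apply: Kn.
  + apply: (new _ a) => //; apply: (pivK _ b) => //.
    by apply: (pivS _ k) => //; apply: Kn.
- by move=> i j ilt jlt /(sub _ _ ilt jlt) e; rewrite /block_update e.
- move=> i j ilt jlt /updP[|[k [kK e1 e2]]]; first exact: sound.
  by apply: (@R_trans i k j) => //; try exact: Kn; apply: sound => //; apply: Kn.
Qed.

End Block.

Lemma closure_inv_ext (S S' : pred nat) (D E : rel nat) :
  (forall k, k < n -> S' k -> S k) ->
  (forall i j, i < n -> j < n -> D i j = E i j) ->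
  closure_inv S D -> closure_inv S' E.
Proof.
move=> SS DE [piv sub sound]; split.
- move=> i k j ilt klt jlt kS; rewrite -!DE //.
  by apply: piv => //; apply: SS.
- by move=> i j ilt jlt; rewrite -DE //; apply: sub.
- by move=> i j ilt jlt; rewrite -DE //; apply: sound.
Qed.

End Closure.

(** * Comparison with reachability in the graph *)

Section Reachability.
Variables (n : nat) (G : digraph n).

(** Relations live on [nat] so that computed indices such as [p + a] need no bound proof; the value
    outside the range is arbitrary. *)
Definition lift_rel (r : rel 'I_n) : rel nat := fun i j =>
  if (insub i, insub j) is (Some i', Some j') then r i' j' else false.

Lemma lift_relE (r : rel 'I_n) (i j : 'I_n) : lift_rel r i j = r i j.
Proof. by rewrite /lift_rel !valK. Qed.

Definition reflexive_adjacency : rel nat :=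
  lift_rel (fun i j => G i j || (i == j)).

Lemma lift_connect_trans i k j : i < n -> k < n -> j < n ->
  lift_rel (connect G) i k -> lift_rel (connect G) k j ->
  lift_rel (connect G) i j.
Proof.
move=> ilt klt jlt.
rewrite -[i]/(val (Ordinal ilt)) -[k]/(val (Ordinal klt)) -[j]/(val (Ordinal jlt)).
by rewrite !lift_relE; apply: connect_trans.
Qed.

Lemma closure_inv_start :
  closure_inv n reflexive_adjacency (lift_rel (connect G)) xpred0
    reflexive_adjacency.
Proof.
split=> // i j ilt jlt.
rewrite -[i]/(val (Ordinal ilt)) -[j]/(val (Ordinal jlt)) /reflexive_adjacency.
by rewrite !lift_relE => /orP[/connect1 //|/eqP ->]; apply: connect0.
Qed.

(** Induction along a path: its first edge is in [D], and its second vertex is a pivot. The empty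
    path needs the diagonal, which is why it is added to the adjacency relation beforehand. *)
Lemma closure_inv_end (S : pred nat) (D : rel nat) :
  (forall k, k < n -> S k) ->
  closure_inv n reflexive_adjacency (lift_rel (connect G)) S D ->
  forall i j : 'I_n, D i j = connect G i j.
Proof.
move=> allS [piv sub sound] i j; apply/idP/idP.
  by rewrite -[connect _ _ _]lift_relE; apply: sound.
case/connectP=> p; elim: p i => [|k p IH] i /=.
  by move=> _ ->; apply: sub => //; rewrite /reflexive_adjacency lift_relE eqxx orbT.
case/andP=> ik kp e; apply: (piv i k j) => //; first exact: allS.
  by apply: sub => //; rewrite /reflexive_adjacency lift_relE ik.
exact: IH.
Qed.

End Reachability.

(** * The program and its correctness *)

Declare Scope expr_scope.
Delimit Scope expr_scope with X.
Bind Scope expr_scope with expr.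
Notation "e1 + e2" := (Bin Defs.Add e1 e2) : expr_scope.
Notation "e1 - e2" := (Bin Defs.Sub e1 e2) : expr_scope.
Notation "e1 * e2" := (Bin Defs.Mul e1 e2) : expr_scope.
Notation "e1 / e2" := (Bin Defs.Div e1 e2) : expr_scope.
Coercion Var : nat >-> expr.

(** Registers 0 to 2 are imposed by [init]. Those below [vk] are constant after [setup], so
    [params_agree] recognises harmless code by comparing register numbers with [vk]. *)
Definition vn := 0.
Definition vs := 1.
Definition vl := 2.
Definition vheight := 3.
Definition vblocks := 4.
Definition vflag := 5.
Definition vlast := 6.
Definition vA := 7.
Definition vB := 8.
Definition vC := 9.
Definition vk := 10.
Definition vp := 11.
Definition va := 12.
Definition vi := 13.
Definition vj := 14.
Definition vc := 15.
Definition vr := 16.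
Definition vpad := 17.

(* Truncated subtraction turns [a - (a - b)] into [min(a, b)] and
   [1 - (1 - a)] into [min(1, a)]. *)
Definition emin (e1 e2 : expr) : expr := (e1 - (e1 - e2))%X.
Definition eclamp (e : expr) : expr := (Cst 1 - (Cst 1 - e))%X.
Definition ecell (e1 e2 : expr) : expr := (e1 * vn + e2)%X.

Definition diagonal_addr : expr := ecell vi vi.
Definition diagonal : cmd := For vi vn (Store diagonal_addr (Cst 1)).

Definition panel_addr : expr := ecell (vp + vi)%X vj.
Definition panel_val : expr :=
  eclamp (Ld panel_addr + Ld (ecell (vp + vi)%X (vp + va)%X)
                          * Ld (ecell (vp + va)%X vj))%X.
Definition panel_pass : cmd :=
  For vi vheight (For vj vn (Store panel_addr panel_val)).

Definition left_addr : expr := (vA + (vi * vs + vj))%X.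
Definition left_val : expr := Ld (ecell vi (vp + vj)%X).
Definition copy_left : cmd :=
  For vi vn (For vj vs (Store left_addr left_val)).

Definition right_addr : expr := (vB + (vi * vs + vj))%X.
Definition right_val : expr := Ld (ecell (vp + vi)%X (vr + vj)%X).
Definition copy_right : cmd :=
  For vi vs (For vj vs (Store right_addr right_val)).

Definition merge_addr : expr := ecell vi (vr + vj)%X.
Definition merge_val : expr :=
  eclamp (Ld merge_addr + Ld (vC + (vi * vs + vj)))%X.
Definition merge_product : cmd :=
  For vi vn (For vj vs (Store merge_addr merge_val)).

Definition column_pass : cmd :=
  Seq (Assign vr (emin (vc * vs)%X vlast))
    (Seq copy_right (Seq (Mult vA vB vC vn) merge_product)).

Definition block_pass : cmd :=
  Seq (Assign vp (emin (vk * vs)%X vlast))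
    (Seq (For va vheight panel_pass)
       (When vflag (Seq copy_left (For vc vblocks column_pass)))).

(** Vanishes when [s <= n]. Otherwise n^3 / s is below n^2 s, so the two remaining terms of the
    bound suffice. *)
Definition padding : expr :=
  ((Cst 1 - vflag) * (vn * vn * vs + vn * vn * vl / (vs * vs)))%X.

Definition setup : cmd :=
  Seq (Assign vheight (emin vn vs))
    (Seq (Assign vblocks ((vn + vs - Cst 1) / vs)%X)
       (Seq (Assign vflag (Cst 1 - (vs - vn))%X)
          (Seq (Assign vlast (vn - vheight)%X)
             (Seq (Assign vA (vn * vn)%X)
                (Seq (Assign vB (vA + vn * vs)%X)
                   (Assign vC (vB + vs * vs)%X)))))).

Definition closure_cmd : cmd :=
  Seq setup
    (Seq diagonal
       (Seq (For vk vblocks block_pass)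
          (Seq (Assign vpad padding) (For vi vpad Skip)))).

Lemma cell_inj c i j i' j' :
  j < c -> j' < c -> i * c + j = i' * c + j' -> i = i' /\ j = j'.
Proof.
move=> jc j'c e; have c0 : 0 < c by apply: leq_ltn_trans jc.
have := f_equal (divn^~ c) e; have := f_equal (modn^~ c) e.
by rewrite !modnMDl !divnMDl // !modn_small // !divn_small // !addn0.
Qed.

Lemma cell_lt r c i j : i < r -> j < c -> i * c + j < r * c.
Proof. by move=> ir jc; nia. Qed.

Lemma write_mx_cell r c M a (A : 'M[nat]_(r, c)) (i : 'I_r) (j : 'I_c) :
  write_mx M a A (a + (i * c + j)) = A i j.
Proof.
have c0 : 0 < c by apply: leq_ltn_trans (ltn_ord j).
rewrite /write_mx leq_addr addKn divnMDl // modnMDl.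
by rewrite modn_small // divn_small // addn0 !valK.
Qed.

Lemma write_mx_below r c M a (A : 'M[nat]_(r, c)) x :
  x < a -> write_mx M a A x = M x.
Proof. by rewrite /write_mx ltnNge => /negPf ->. Qed.

(** * Effect and exact cost of each phase *)

Section Correctness.
Variables (w n s l : nat).

(** These quantities follow the machine expressions literally, truncated subtraction included, so
    that [setup_exec] is mostly computation. Memory holds the matrix, then the n x s left operand,
    the s x s right operand and the n x s product. *)
Definition height := n - (n - s).
Definition blocks := (n + s - 1) %/ s.
Definition last_start := n - height.
Definition addrA := n * n.
Definition addrB := addrA + n * s.
Definition addrC := addrB + s * s.

Lemma height_minn : height = minn n s.
Proof. by rewrite /height; lia. Qed.

Hypothesis s_gt0 : 0 < s.

Lemma blocks_bounds : n <= blocks * s < n + s.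
Proof.
rewrite /blocks; have := divn_eq (n + s - 1) s.
by have := ltn_pmod (n + s - 1) s_gt0; lia.
Qed.

Hypothesis n_gt0 : 0 < n.
Hypothesis space : addrC + n * s + n + s + 1 < 2 ^ w.

Local Notation env := (nat -> nat).
Local Notation exec := (exec w s l).

Lemma word_gt1 : 1 < 2 ^ w.
Proof. by move: space; lia. Qed.

Definition params (r : env) :=
  [/\ [/\ r vn = n, r vs = s, r vl = l & r vheight = height],
      [/\ r vblocks = blocks, r vflag = (s <= n) & r vlast = last_start]
    & [/\ r vA = addrA, r vB = addrB & r vC = addrC]].

Lemma params_agree (xs : seq nat) r r' :
  agree xs r r' -> all (leq vk) xs -> params r -> params r'.
Proof.
move=> agr /allP xsk; have E x : x < vk -> r' x = r x.
  by move=> xk; apply/agr/negP => /xsk; lia.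
by rewrite /params !E.
Qed.

Definition holds (M : memory) (D : rel nat) :=
  forall i j, i < n -> j < n -> M (i * n + j) = D i j.

Definition diagonal_cost := 3 + n * (store_cost diagonal_addr (Cst 1) + 5).

Lemma diagonal_exec r M (D : rel nat) :
  params r -> holds M D ->
  exists r' M', [/\ exec diagonal r M diagonal_cost r' M', params r'
                  & holds M' (fun i j => D i j || (i == j))].
Proof.
move=> pr HM; have [[rn rs rl rh] [rq rf rlast] [rA rB rC]] := pr.
have [|||||r' [M' [ex agr [F1 F2]]]] :=
  @fill_rule w s l word_gt1 vi vn diagonal_addr (Cst 1) n (fun i => i * n + i)
    (fun=> 1) r M.
- by [].
- by [].
- by move: space; rewrite /addrC /addrB /addrA; lia.
- by move=> i j ilt jlt /(cell_inj ilt jlt)[].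
- move=> i r' M' ilt r'i agr _ _.
  have [[rn' _ _ _] _ _] := params_agree agr isT pr.
  have := cell_lt ilt ilt; move: space; rewrite /addrC /addrB /addrA => sp lt.
  by split=> //=; rewrite ?r'i ?rn' //; lia.
exists r', M'; split=> //; first exact: params_agree agr isT pr.
move=> i j ilt jlt; case: eqP => [<-|ij]; first by rewrite F1 ?orbT.
rewrite orbF F2 ?HM // => k klt; apply/eqP => /(cell_inj jlt klt)[e1 e2].
by apply: ij; rewrite e1 e2.
Qed.

Definition panel_pass_cost := fill2_cost panel_addr panel_val height n.

Lemma panel_pass_exec r M (E : rel nat) p a :
  params r -> r vp = p -> r va = a -> p + height <= n -> a < height ->
  holds M E ->
  exists r' M', [/\ exec panel_pass r M panel_pass_cost r' M',
                    agree [:: vi; vj] r r'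
                  & holds M' (panel_pivot p height a E)].
Proof.
move=> pr rp ra ph ah HM; have [[rn rs rl rh] [rq rf rlast] [rA rB rC]] := pr.
pose F i j := E (p + i) j || E (p + i) (p + a) && E (p + a) j.
have [|||||||r' [M' [ex agr [F1 F2]]]] :=
  @fill2_rule w s l word_gt1 vi vheight vj vn panel_addr panel_val height n
    (fun i j => (p + i) * n + j) (fun i j => F i j : nat) r M.
- by [].
- by [].
- by [].
- by move: space; rewrite /addrC /addrB /addrA; lia.
- by move: space; rewrite /addrC /addrB /addrA; lia.
- move=> i j i' j' ilt jlt i'lt j'lt /(cell_inj jlt j'lt)[e1 e2].
  by split=> //; lia.
- move=> i j r' M' ilt jlt r'i r'j agr pf fresh.
  have [[rn' _ _ _] _ _] := params_agree agr isT pr.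
  have rp' : r' vp = p by rewrite agr.
  have ra' : r' va = a by rewrite agr.
  have pin : p + i < n by lia.
  have pan : p + a < n by lia.
  have M1 : M' ((p + i) * n + j) = E (p + i) j by rewrite fresh HM.
  (* The pivot column and the pivot row may have been overwritten already; by absorption their new
     values equal the old ones. *)
  have M2 : M' ((p + i) * n + (p + a)) = E (p + i) (p + a).
    case: (pf ((p + i) * n + (p + a))) => [->|[i' [j' [i'lt j'lt + ->]]]].
      exact: HM.
    move=> /(cell_inj pan j'lt)[e1 <-]; rewrite /F -e1.
    by case: (E (p + i) (p + a)).
  have M3 : M' ((p + a) * n + j) = E (p + a) j.
    case: (pf ((p + a) * n + j)) => [->|[i' [j' [i'lt j'lt + ->]]]].
      exact: HM.
    move=> /(cell_inj jlt j'lt)[e1 <-]; rewrite /F -e1.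
    by case: (E (p + a) j); rewrite ?andbF ?andbT.
  have b1 := cell_lt pin jlt; have b2 := cell_lt pin pan.
  have b3 := cell_lt pan jlt.
  move: space; rewrite /addrC /addrB /addrA => sp.
  split=> //=; rewrite ?r'i ?r'j ?rn' ?rp' ?ra' // ?M1 ?M2 ?M3 ?/F.
  + by lia.
  + by case: (E (p + i) j); case: (E (p + i) (p + a)); case: (E (p + a) j) => /=; lia.
  + by case: (E (p + i) j); case: (E (p + i) (p + a)); case: (E (p + a) j).
exists r', M'; split=> // i j ilt jlt; rewrite /panel_pivot.
case: ifPn => iK.
  move: iK; rewrite /in_block => /andP[pi ip].
  by have := F1 (i - p) j; rewrite /F !subnKC // => ->; lia.
rewrite F2 ?HM // => i' j' i'lt j'lt; apply/eqP => /(cell_inj jlt j'lt)[e1 _].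
by move: iK; rewrite e1 /in_block; lia.
Qed.

Lemma panel_loop_exec r M (D0 R : rel nat) (S : pred nat) (D : rel nat) p :
  (forall i k j, i < n -> k < n -> j < n -> R i k -> R k j -> R i j) ->
  params r -> r vp = p -> p + height <= n ->
  closure_inv n D0 R S D -> holds M D ->
  exists r' M' E,
    [/\ exec (For va vheight panel_pass) r M
          (3 + height * (panel_pass_cost + 5)) r' M',
        agree [:: va; vi; vj] r r', panel_inv n D0 R S D p height height E
      & holds M' E].
Proof.
move=> Rtr pr rp ph inv HM.
have [[rn rs rl rh] [rq rf rlast] [rA rB rC]] := pr.
have [||||||r' [M' [ex agr [E [HE HM']]]]] :=
  @for_rule w s l word_gt1 va vheight panel_pass panel_pass_cost height
    (fun a M => exists E, panel_inv n D0 R S D p height a E /\ holds M E) r M.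
- by [].
- by [].
- by [].
- by move: space; rewrite /height; lia.
- by exists D; split=> //; apply: panel_start.
- move=> a r' M' alt r'a agr [E [HE HM']].
  have pr' := params_agree agr isT pr.
  have rp' : r' vp = p by rewrite agr.
  have [r1 [M1 [ex1 agr1 HM1]]] := panel_pass_exec pr' rp' r'a ph alt HM'.
  exists r1, M1; split=> //; exists (panel_pivot p height a E); split=> //.
  exact: panel_step.
by exists r', M', E.
Qed.

Definition left_ok (M : memory) (E : rel nat) (p : nat) :=
  forall i j, i < n -> j < s -> M (addrA + (i * s + j)) = E i (p + j).

Definition copy_left_cost := fill2_cost left_addr left_val n s.

Lemma copy_left_exec r M (E : rel nat) p :
  params r -> r vp = p -> p + s <= n -> holds M E ->
  exists r' M', [/\ exec copy_left r M copy_left_cost r' M',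
                    agree [:: vi; vj] r r', holds M' E & left_ok M' E p].
Proof.
move=> pr rp ps HM; have [[rn rs rl rh] [rq rf rlast] [rA rB rC]] := pr.
have [|||||||r' [M' [ex agr [F1 F2]]]] :=
  @fill2_rule w s l word_gt1 vi vn vj vs left_addr left_val n s
    (fun i j => addrA + (i * s + j)) (fun i j => E i (p + j) : nat) r M.
- by [].
- by [].
- by [].
- by move: space; lia.
- by move: space; lia.
- by move=> i j i' j' ilt jlt i'lt j'lt /addnI /(cell_inj jlt j'lt).
- move=> i j r' M' ilt jlt r'i r'j agr pf fresh.
  have [[rn' rs' _ _] _ [rA' _ _]] := params_agree agr isT pr.
  have rp' : r' vp = p by rewrite agr.
  have pjn : p + j < n by lia.
  have b1 := cell_lt ilt pjn; have b2 := cell_lt ilt jlt.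
  have M1 : M' (i * n + (p + j)) = E i (p + j).
    case: (pf (i * n + (p + j))) => [->|[i' [j' [i'lt j'lt e _]]]].
      exact: HM.
    by move: e; rewrite /addrA; lia.
  move: space; rewrite /addrC /addrB /addrA => sp.
  split=> //=; rewrite ?r'i ?r'j ?rn' ?rs' ?rp' ?rA' ?M1 // /addrA.
    by lia.
  by case: (E i (p + j)) => /=; lia.
exists r', M'; split=> // i j ilt jlt.
rewrite F2 ?HM // => i' j' _ _; have := cell_lt ilt jlt.
by rewrite /addrA; lia.
Qed.

Definition copy_right_cost := fill2_cost right_addr right_val s s.

Lemma copy_right_exec r (M : memory) (D : rel nat) p c :
  params r -> r vp = p -> r vr = c -> p + s <= n -> c + s <= n -> holds M D ->
  exists r' M', [/\ exec copy_right r M copy_right_cost r' M',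
                    agree [:: vi; vj] r r',
                    forall x, x < addrB -> M' x = M x
                  & forall i j, i < s -> j < s ->
                      M' (addrB + (i * s + j)) = D (p + i) (c + j)].
Proof.
move=> pr rp rc ps cs HM; have [[rn rs rl rh] [rq rf rlast] [rA rB rC]] := pr.
have [|||||||r' [M' [ex agr [F1 F2]]]] :=
  @fill2_rule w s l word_gt1 vi vs vj vs right_addr right_val s s
    (fun i j => addrB + (i * s + j)) (fun i j => D (p + i) (c + j) : nat) r M.
- by [].
- by [].
- by [].
- by move: space; lia.
- by move: space; lia.
- by move=> i j i' j' ilt jlt i'lt j'lt /addnI /(cell_inj jlt j'lt).
- move=> i j r' M' ilt jlt r'i r'j agr pf fresh.
  have [[rn' rs' _ _] _ [_ rB' _]] := params_agree agr isT pr.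
  have rp' : r' vp = p by rewrite agr.
  have rc' : r' vr = c by rewrite agr.
  have pin : p + i < n by lia.
  have cjn : c + j < n by lia.
  have b1 := cell_lt pin cjn; have b2 := cell_lt ilt jlt.
  have M1 : M' ((p + i) * n + (c + j)) = D (p + i) (c + j).
    case: (pf ((p + i) * n + (c + j))) => [->|[i' [j' [i'lt j'lt e _]]]].
      exact: HM.
    by move: e; rewrite /addrB /addrA; lia.
  move: space; rewrite /addrC /addrB /addrA => sp.
  split=> //=; rewrite ?r'i ?r'j ?rn' ?rs' ?rp' ?rc' ?rB' ?M1 // /addrB /addrA.
    by lia.
  by case: (D (p + i) (c + j)) => /=; lia.
exists r', M'; split=> // x xlt.
by rewrite F2 // => i' j' _ _; lia.
Qed.

(** An entry of the integer product counts the middle vertices: it is at most [s], so it fits in a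
    word, and it is positive exactly when the boolean product holds. *)
Lemma mult_exec r (M : memory) (A B : rel nat) :
  params r -> s <= n ->
  (forall i j, i < n -> j < s -> M (addrA + (i * s + j)) = A i j) ->
  (forall i j, i < s -> j < s -> M (addrB + (i * s + j)) = B i j) ->
  exists M', [/\ exec (Mult vA vB vC vn) r M (n * s + l) r M',
                 forall x, x < addrC -> M' x = M x
               & forall i j, i < n -> j < s ->
                   M' (addrC + (i * s + j)) <= s /\
                   (0 < M' (addrC + (i * s + j)))
                   = [exists a : 'I_s, A i a && B a j]].
Proof.
move=> pr sn HA HB; have [[rn rs rl rh] [rq rf rlast] [rA rB rC]] := pr.
set C := (read_mx M addrA n s *m read_mx M addrB s s)%R.
have CE i j : C i j = \sum_(a < s) A i a * B a j.
  rewrite /C mxE; apply: eq_bigr => a _; rewrite !mxE HA ?HB //.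
have C_le i j : C i j <= s.
  rewrite CE -[X in _ <= X]card_ord -sum1_card; apply: leq_sum => a _.
  by case: (A i a); case: (B a j).
exists (write_mx M addrC C); split.
- have := @exec_mult w s l vA vB vC vn r M; rewrite rn rA rB rC; apply.
  move: space; rewrite /mult_ok /addrC /addrB /addrA => sp.
  apply/and5P; split=> //; try lia.
  by apply/forallP => i; apply/forallP => j; apply: leq_ltn_trans (C_le i j) _; lia.
- by move=> x xlt; apply: write_mx_below.
move=> i j ilt jlt.
have := write_mx_cell M addrC C (Ordinal ilt) (Ordinal jlt) => /= ->.
split; first exact: C_le.
rewrite CE lt0n sum_nat_eq0 negb_forall; apply: eq_existsb => a /=.
by case: (A i a); case: (B a j).
Qed.

Definition merge_cost := fill2_cost merge_addr merge_val n s.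

Lemma merge_exec r (M : memory) (D P : rel nat) c :
  params r -> r vr = c -> c + s <= n -> holds M D ->
  (forall i j, i < n -> j < s ->
     M (addrC + (i * s + j)) <= s /\
     (0 < M (addrC + (i * s + j))) = P i (c + j)) ->
  exists r' M', [/\ exec merge_product r M merge_cost r' M',
                    agree [:: vi; vj] r r',
                    forall x, addrA <= x -> M' x = M x
                  & holds M' (fun i j =>
                      D i j || (c <= j < c + s) && P i j)].
Proof.
move=> pr rc cs HM HC; have [[rn rs rl rh] [rq rf rlast] [rA rB rC]] := pr.
have [|||||||r' [M' [ex agr [F1 F2]]]] :=
  @fill2_rule w s l word_gt1 vi vn vj vs merge_addr merge_val n s
    (fun i j => i * n + (c + j))
    (fun i j => D i (c + j) || P i (c + j) : nat) r M.
- by [].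
- by [].
- by [].
- by move: space; lia.
- by move: space; lia.
- move=> i j i' j' ilt jlt i'lt j'lt.
  by move=> /cell_inj[||-> /addnI //]; lia.
- move=> i j r' M' ilt jlt r'i r'j agr pf fresh.
  have [[rn' rs' _ _] _ [_ _ rC']] := params_agree agr isT pr.
  have rc' : r' vr = c by rewrite agr.
  have cjn : c + j < n by lia.
  have b1 := cell_lt ilt cjn; have b2 := cell_lt ilt jlt.
  have M1 : M' (i * n + (c + j)) = D i (c + j) by rewrite fresh HM.
  have M2 : M' (addrC + (i * s + j)) = M (addrC + (i * s + j)).
    case: (pf (addrC + (i * s + j))) => [//|[i' [j' [i'lt j'lt e _]]]].
    have cj'n : c + j' < n by lia.
    have := cell_lt i'lt cj'n; move: e.
    by rewrite /addrC /addrB /addrA; lia.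
  have [le_s pos] := HC i j ilt jlt.
  move: space; rewrite /addrC /addrB /addrA in M2 le_s pos * => sp.
  split=> //=; rewrite ?r'i ?r'j ?rn' ?rs' ?rc' ?rC' //
    /addrC /addrB /addrA ?M1 ?M2.
  + by lia.
  + by case: (D i (c + j)) => /=; lia.
  + by rewrite -pos; case: (D i (c + j)) => /=; lia.
exists r', M'; split=> //.
  move=> x xle; rewrite F2 // => i j ilt jlt.
  have cjn : c + j < n by lia.
  by have := cell_lt ilt cjn; move: xle; rewrite /addrA; lia.
move=> i j ilt jlt; case: (boolP (c <= j < c + s)) => /= jc.
  by have := F1 i (j - c); rewrite subnKC; [move=> ->; lia|lia].
rewrite orbF F2 ?HM // => i' j' i'lt j'lt; apply/eqP => /cell_inj[||_ e]; lia.
Qed.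

Definition block_start c := c * s - (c * s - last_start).

Lemma block_lt c : c < blocks -> c * s < n.
Proof.
move=> cb; have /andP[_ lt] := blocks_bounds.
by have : c.+1 * s <= blocks * s by [rewrite leq_mul2r cb orbT]; lia.
Qed.

Lemma block_startE c : block_start c = minn (c * s) last_start.
Proof. by rewrite /block_start; lia. Qed.

Lemma block_start_le c : block_start c + height <= n.
Proof. by rewrite /block_start /last_start height_minn; lia. Qed.

(** Shifting a block to the left only covers again vertices below [c * s], so the vertices treated
    after each block still form an initial segment. *)
Lemma block_startP c j : c < blocks -> j < n ->
  (j < c.+1 * s) = (j < c * s) || (block_start c <= j < block_start c + height).
Proof.
move=> /block_lt cn jn; rewrite block_startE /last_start height_minn mulSn.
by case: (posnP c) => [->|c0]; nia.
Qed.

Lemma start_exec x y r M :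
  params r -> r y * s < n ->
  exec (Assign x (emin (y * vs)%X vlast)) r M
    (expr_size (emin (y * vs)%X vlast) + 2) (upd r x (block_start (r y))) M.
Proof.
move=> pr yb; have [[rn rs rl rh] [rq rf rlast] [rA rB rC]] := pr.
have := @exec_assign w s l x (emin (y * vs)%X vlast) r M.
rewrite /= rs rlast; apply.
have := leq_pmulr (r y) s_gt0; move: space; rewrite /last_start; lia.
Qed.

Definition start_cost := expr_size (emin (vc * vs)%X vlast) + 2.

Definition column_pass_cost :=
  start_cost + (copy_right_cost + (n * s + l + merge_cost)).

(** [E] is the matrix at the end of the panel and [D] the current one. The left operand is a saved
    copy of [E]; the right one is read from [D], in rows of the block, where both agree. So the
    product is that of [E] even after other columns have changed. *)
Lemma column_pass_exec r M (E D : rel nat) p c :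
  params r -> r vp = p -> r vc = c -> s <= n -> p + s <= n -> c < blocks ->
  left_ok M E p -> holds M D ->
  (forall i j, i < n -> j < n -> in_block p s i -> D i j = E i j) ->
  exists r' M', [/\ exec column_pass r M column_pass_cost r' M',
                    left_ok M' E p
                  & holds M' (fun i j => D i j ||
                      in_block (block_start c) s j && block_product p s E i j)].
Proof.
move=> pr rp rc sn ps cb HL HM DE.
have hs : height = s by rewrite height_minn; lia.
have ex1 := start_exec vr M pr (eq_ind_r (fun z => z * s < n) (block_lt cb) rc).
rewrite rc in ex1; set r1 := upd r vr (block_start c) in ex1.
have agr1 : agree [:: vr] r r1 by apply: exec_agree ex1.
have pr1 := params_agree agr1 isT pr.
have rp1 : r1 vp = p by rewrite agr1.
have rr1 : r1 vr = block_start c by rewrite /r1 upd_same.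
have cs : block_start c + s <= n by rewrite -[X in _ + X]hs block_start_le.
have [r2 [M2 [ex2 agr2 low2 HB]]] := copy_right_exec pr1 rp1 rr1 ps cs HM.
have pr2 := params_agree agr2 isT pr1.
have HA2 i j : i < n -> j < s -> M2 (addrA + (i * s + j)) = E i (p + j).
  move=> ilt jlt; rewrite low2 ?HL //; have := cell_lt ilt jlt.
  by rewrite /addrB; lia.
have HM2 : holds M2 D.
  move=> i j ilt jlt; rewrite low2 ?HM //; have := cell_lt ilt jlt.
  by rewrite /addrB /addrA; lia.
have [M3 [ex3 low3 HC]] :=
  mult_exec (A := fun i j => E i (p + j))
    (B := fun i j => D (p + i) (block_start c + j)) pr2 sn HA2 HB.
have HM3 : holds M3 D.
  move=> i j ilt jlt; rewrite low3 ?HM2 //; have := cell_lt ilt jlt.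
  by rewrite /addrC /addrB /addrA; lia.
have rr2 : r2 vr = block_start c by rewrite agr2.
have HC' i j : i < n -> j < s -> M3 (addrC + (i * s + j)) <= s /\
    (0 < M3 (addrC + (i * s + j))) = block_product p s E i (block_start c + j).
  move=> ilt jlt; have [le pos] := HC i j ilt jlt; split=> //; rewrite pos.
  apply: eq_existsb => a /=; rewrite DE //; have := ltn_ord a; try lia.
  by rewrite /in_block; lia.
have [r4 [M4 [ex4 agr4 high4 HM4]]] := merge_exec pr2 rr2 cs HM3 HC'.
exists r4, M4; split=> //.
  apply: exec_seq ex1 _; apply: exec_seq ex2 _; exact: exec_seq ex3 ex4.
move=> i j ilt jlt; rewrite high4 ?leq_addr // low3 ?HA2 //.
by have := cell_lt ilt jlt; rewrite /addrC /addrB; lia.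
Qed.

Definition tensor_phase_cost :=
  copy_left_cost + (3 + blocks * (column_pass_cost + 5)).

Lemma tensor_phase_exec r M (D0 R : rel nat) (S : pred nat) (D E : rel nat) p :
  params r -> r vp = p -> s <= n -> p + s <= n ->
  panel_inv n D0 R S D p s s E -> holds M E ->
  exists r' M', [/\ exec (Seq copy_left (For vc vblocks column_pass)) r M
                      tensor_phase_cost r' M'
                  & holds M' (block_update p s E)].
Proof.
move=> pr rp sn ps HE HM.
have hs : height = s by rewrite height_minn; lia.
have [r1 [M1 [ex1 agr1 HM1 HL1]]] := copy_left_exec pr rp ps HM.
have pr1 := params_agree agr1 isT pr.
have [_ [rq _ _] _] := pr1.
have rp1 : r1 vp = p by rewrite agr1.
have /andP[le_b lt_b] := blocks_bounds.
(* Columns below [c * s] carry the update and the others are still those of [E]. A column treated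
   twice because of the overlap is unaffected, disjunction being idempotent. *)
have [||||||r2 [M2 [ex2 agr2 [HL2 HM2]]]] :=
  @for_rule w s l word_gt1 vc vblocks column_pass column_pass_cost blocks
    (fun c M => left_ok M E p /\
       holds M (fun i j => if j < c * s then block_update p s E i j else E i j))
    r1 M1.
- by [].
- by [].
- by [].
- by have := leq_pmulr blocks s_gt0; move: space; lia.
- by split.
- move=> c r' M' cb r'c agr [HL HM'].
  have pr' := params_agree agr isT pr1.
  have rp' : r' vp = p by rewrite agr.
  have [|r3 [M3 [ex3 HL3 HM3]]] :=
    column_pass_exec pr' rp' r'c sn ps cb HL HM'.
    move=> i j ilt jlt iK /=; case: ifP => // _.
    exact: panel_block_update HE ilt jlt iK.
  exists r3, M3; split=> //; split=> // i j ilt jlt; rewrite HM3 //=.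
  rewrite (block_startP cb jlt) hs -/(in_block (block_start c) s j).
  rewrite /block_update.
  by case: (in_block _ s j); case: (j < c * s); rewrite /= ?orbF // -orbA orbb.
exists r2, M2; split; first exact: exec_seq ex1 ex2.
by move=> i j ilt jlt; rewrite HM2 // (leq_trans jlt le_b).
Qed.

Definition block_pass_cost :=
  start_cost + (3 + height * (panel_pass_cost + 5)
                + (if s <= n then 1 + tensor_phase_cost else 1)).

Lemma block_pass_exec r M (D0 R : rel nat) (D : rel nat) k :
  (forall i k j, i < n -> k < n -> j < n -> R i k -> R k j -> R i j) ->
  params r -> r vk = k -> k < blocks ->
  closure_inv n D0 R (fun v => v < k * s) D -> holds M D ->
  exists r' M' D',
    [/\ exec block_pass r M block_pass_cost r' M',
        closure_inv n D0 R (fun v => v < k.+1 * s) D' & holds M' D'].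
Proof.
move=> Rtr pr rk kb inv HM.
have ex1 := start_exec vp M pr (eq_ind_r (fun z => z * s < n) (block_lt kb) rk).
rewrite rk in ex1; set r1 := upd r vp (block_start k) in ex1.
have agr1 : agree [:: vp] r r1 by apply: exec_agree ex1.
have pr1 := params_agree agr1 isT pr.
have rp1 : r1 vp = block_start k by rewrite /r1 upd_same.
have ph := block_start_le k.
have [r2 [M2 [E [ex2 agr2 HE HM2]]]] := panel_loop_exec Rtr pr1 rp1 ph inv HM.
have pr2 := params_agree agr2 isT pr1.
have rp2 : r2 vp = block_start k by rewrite agr2.
have inv' : closure_inv n D0 R (fun v => v < k.+1 * s)
              (block_update (block_start k) height E).
  apply: closure_inv_ext (block_update_closure Rtr ph inv HE) => // v vn.
  by rewrite block_startP.
have [_ [_ rf _] _] := pr2; rewrite /block_pass_cost.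
case: (leqP s n) rf => [sn|ns] /= rf.
  have hs : height = s by rewrite height_minn; lia.
  rewrite hs in ph HE inv'.
  have [r3 [M3 [ex3 HM3]]] := tensor_phase_exec pr2 rp2 sn ph HE HM2.
  exists r3, M3, (block_update (block_start k) s E); split=> //.
  apply: exec_seq ex1 _; apply: exec_seq ex2 _.
  by apply: exec_when1; rewrite ?rf.
exists r2, M2, (block_update (block_start k) height E); split=> //.
  by apply: exec_seq ex1 _; apply: exec_seq ex2 _; apply: exec_when0.
(* For n < s the only block contains all rows, and on block rows the update is the identity: the
   panel alone finished the work. *)
move=> i j ilt jlt; rewrite HM2 // (panel_block_update ph HE) //.
by rewrite /in_block /block_start /last_start height_minn; lia.
Qed.

Definition main_loop_cost := 3 + blocks * (block_pass_cost + 5).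

Lemma main_loop_exec r M (D0 R : rel nat) (D : rel nat) :
  (forall i k j, i < n -> k < n -> j < n -> R i k -> R k j -> R i j) ->
  params r -> closure_inv n D0 R xpred0 D -> holds M D ->
  exists r' M' D',
    [/\ exec (For vk vblocks block_pass) r M main_loop_cost r' M', params r',
        closure_inv n D0 R (fun v => v < n) D' & holds M' D'].
Proof.
move=> Rtr pr inv HM; have [_ [rq _ _] _] := pr.
have /andP[le_b lt_b] := blocks_bounds.
have [||||||r2 [M2 [ex2 agr2 [D2 [inv2 HM2]]]]] :=
  @for_rule w s l word_gt1 vk vblocks block_pass block_pass_cost blocks
    (fun k M => exists D, closure_inv n D0 R (fun v => v < k * s) D /\ holds M D)
    r M.
- by [].
- by [].
- by [].
- by have := leq_pmulr blocks s_gt0; move: space; lia.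
- by exists D.
- move=> k r' M' kb r'k agr [D' [inv' HM']].
  have pr' := params_agree agr isT pr.
  have [r3 [M3 [D3 [ex3 inv3 HM3]]]] := block_pass_exec Rtr pr' r'k kb inv' HM'.
  by exists r3, M3; split=> //; exists D3.
exists r2, M2, D2; split=> //; first exact: params_agree agr2 isT pr.
by apply: closure_inv_ext inv2 => // k kn _; apply: leq_trans kn le_b.
Qed.

Definition padding_count :=
  (1 - (s <= n)) * (n * n * s + n * n * l %/ (s * s)).

Hypothesis space' : n * n * s + n * n * l < 2 ^ w.

Lemma padding_exec r M :
  params r ->
  exists r', exec (Seq (Assign vpad padding) (For vi vpad Skip)) r M
    (expr_size padding + 2 + (3 + padding_count * (0 + 5))) r' M.
Proof.
move=> pr; have [[rn rs rl rh] [rq rf rlast] [rA rB rC]] := pr.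
have le1 : n * n * l %/ (s * s) <= n * n * l by apply: leq_div.
have ex1 : exec (Assign vpad padding) r M (expr_size padding + 2)
             (upd r vpad padding_count) M.
  have := @exec_assign w s l vpad padding r M.
  rewrite /= rn rs rl rf; apply.
  move: space; rewrite /addrC /addrB /addrA => sp.
  have nn0 : 0 < n * n by rewrite muln_gt0 n_gt0.
  have := leq_pmulr (n * n) s_gt0; have := leq_pmull l nn0; move: (_ %/ _) le1 => d le1.
  case: (s <= n) => /=; rewrite ?subn0 ?mul1n ?subnn ?mul0n; lia.
have [||||||r2 [M2 [ex2 agr2 e]]] :=
  @for_rule w s l word_gt1 vi vpad Skip 0 padding_count (fun _ M' => M' = M)
    (upd r vpad padding_count) M.
- by [].
- by [].
- by [].
- by rewrite /padding_count; case: (s <= n); lia.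
- by [].
- by move=> i r' M' _ _ _ ->; exists r', M; split=> //; apply: exec_skip.
by exists r2; apply: exec_seq ex1 _; rewrite -{2}e.
Qed.

Lemma setup_exec r M :
  r vn = n -> r vs = s -> r vl = l ->
  exists r', exec setup r M (cmd_size setup) r' M /\ params r'.
Proof.
move=> rn rs rl.
move: space; rewrite /addrC /addrB /addrA => sp.
have bl : (n + s - 1) %/ s <= n + s - 1 by apply: leq_div.
eexists; split.
  do 6!(apply: exec_seq; first by apply: exec_assign => /=;
          rewrite ?/upd /= ?rn ?rs; lia).
  by apply: exec_assign => /=; rewrite ?/upd /= ?rn ?rs; lia.
rewrite /params /upd /= rn rs rl; split; split=> //.
- by lia.
Qed.

Definition total_cost :=
  cmd_size setup
  + (diagonal_cost
     + (main_loop_cost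
        + (expr_size padding + 2 + (3 + padding_count * (0 + 5))))).

Lemma closure_cmd_exec (G : digraph n) r M :
  r vn = n -> r vs = s -> r vl = l -> holds M (lift_rel G) ->
  exists r' M', exec closure_cmd r M total_cost r' M' /\
    holds M' (lift_rel (connect G)).
Proof.
move=> rn rs rl HM.
have [r1 [ex1 pr1]] := setup_exec M rn rs rl.
have [r2 [M2 [ex2 pr2 HM2]]] := diagonal_exec pr1 HM.
have {}HM2 : holds M2 (reflexive_adjacency G).
  move=> i j ilt jlt; rewrite HM2 //.
  rewrite -[i]/(val (Ordinal ilt)) -[j]/(val (Ordinal jlt)) /reflexive_adjacency.
  by rewrite !lift_relE.
have [r3 [M3 [D [ex3 pr3 inv HM3]]]] :=
  main_loop_exec (@lift_connect_trans n G) pr2 (closure_inv_start G) HM2.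
have [r4 ex4] := padding_exec M3 pr3.
exists r4, M3; split.
  apply: exec_seq ex1 _; apply: exec_seq ex2 _; exact: exec_seq ex3 ex4.
move=> i j ilt jlt; rewrite HM3 //; congr nat_of_bool.
have := closure_inv_end (fun k kn => kn) inv (Ordinal ilt) (Ordinal jlt) => /= ->.
by rewrite -lift_relE.
Qed.

End Correctness.

(** * Running time *)

Section Bounds.
Variables (n s l : nat).
Hypothesis n_gt0 : 0 < n.
Hypothesis s_gt0 : 0 < s.

Local Notation h := (height n s).
Local Notation q := (blocks n s).

(* [s ^ 2] times the bound of the theorem. *)
Definition scaled_bound := n ^ 3 * s + n ^ 2 * l + n ^ 2 * s ^ 3.

(** 80 exceeds the cost of every store to which this is applied, which evaluation checks. Loop
    overhead adds 5 and 8 per level and 3 at the end, still below 100. *)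
Lemma fill2_cost_le ea ev N N' :
  0 < N -> 0 < N' -> store_cost ea ev <= 80 ->
  fill2_cost ea ev N N' <= 100 * (N * N').
Proof.
move=> N0 N'0; rewrite /fill2_cost; move: (store_cost _ _) => c c_le.
have le1 : N' * (c + 5) <= N' * 85 by rewrite leq_mul2l; lia.
have le2 : N * (3 + N' * (c + 5) + 5) <= N * (N' * 93).
  by rewrite leq_mul2l; lia.
have : N * (N' * 93) = 93 * (N * N') by ring.
have : 0 < N * N' by rewrite muln_gt0 N0.
by lia.
Qed.

Lemma height_gt0 : 0 < h. Proof. by rewrite height_minn; lia. Qed.

Lemma blocks_gt0 : 0 < q.
Proof. by have := blocks_bounds n s_gt0; case: q => //; lia. Qed.

Lemma panel_loop_cost_le :
  3 + h * (panel_pass_cost n s + 5) <= 108 * (h * h * n).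
Proof.
have h0 := height_gt0.
have : panel_pass_cost n s <= 100 * (h * n) by apply: fill2_cost_le.
move: (panel_pass_cost n s) h h0 => c k k0 le1.
have k0n : 0 < k * n by rewrite muln_gt0 k0.
have : k * (c + 5) <= k * (105 * (k * n)) by rewrite leq_mul2l; lia.
have : k * (105 * (k * n)) = 105 * (k * k * n) by ring.
have : 0 < k * k * n by rewrite !muln_gt0 k0.
by lia.
Qed.

Lemma tensor_phase_cost_le :
  s <= n -> tensor_phase_cost n s l <= 400 * (q * (n * s + l)).
Proof.
move=> sn; rewrite /tensor_phase_cost /column_pass_cost.
have := fill2_cost_le n_gt0 s_gt0 (isT : store_cost left_addr left_val <= 80).
have := fill2_cost_le s_gt0 s_gt0 (isT : store_cost right_addr right_val <= 80).
have := fill2_cost_le n_gt0 s_gt0 (isT : store_cost merge_addr merge_val <= 80).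
rewrite -/(copy_left_cost n s) -/(copy_right_cost s) -/(merge_cost n s).
have : start_cost <= 20 by [].
move: (copy_left_cost _ _) (copy_right_cost _) (merge_cost _ _) start_cost.
move=> c1 c2 c3 c4 le4 le3 le2 le1.
have ss : s * s <= n * s by rewrite leq_mul2r sn orbT.
have ns0 : 0 < n * s by rewrite muln_gt0 n_gt0.
have := blocks_gt0; move: q => b b0.
have : b * (c4 + (c2 + (n * s + l + c3)) + 5) <= b * (250 * (n * s + l)).
  by rewrite leq_mul2l; lia.
have : n * s + l <= b * (n * s + l) by rewrite leq_pmull.
have : b * (250 * (n * s + l)) = 250 * (b * (n * s + l)) by ring.
by lia.
Qed.

Lemma total_cost_le :
  total_cost n s l + 1 <=
  600 * (q * (h * h * n)) + (s <= n) * (500 * (q * (q * (n * s + l))))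
  + 5 * padding_count n s l.
Proof.
rewrite /total_cost /main_loop_cost /block_pass_cost.
have le1 := panel_loop_cost_le.
have le2 : (if s <= n then 1 + tensor_phase_cost n s l else 1) <=
           1 + (s <= n) * (400 * (q * (n * s + l))).
  case: (leqP s n) => [sn|_] //; have := tensor_phase_cost_le sn.
  by rewrite -[nat_of_bool true]/1 mul1n leq_add2l.
have le3 : diagonal_cost n <= 3 + 60 * n.
  by rewrite /diagonal_cost leq_add2l mulnC leq_mul2r orbT.
have le4 : start_cost <= 20 by [].
have le5 : cmd_size setup <= 100 by [].
have le6 : expr_size padding <= 50 by [].
have h0 := height_gt0; have q0 := blocks_gt0.
have hhn : n <= h * h * n by rewrite leq_pmull // muln_gt0 h0.
have le7 : n <= q * (h * h * n).
  by apply: leq_trans hhn _; rewrite leq_pmull.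
set X := (if _ then _ else _) in le2 *.
move: X (cmd_size setup) (diagonal_cost n) start_cost (expr_size padding)
  (panel_pass_cost n s) (padding_count n s l) le1 le2 le3 le4 le5 le6.
move=> X c1 c2 c3 c4 c5 c6 le1 le2 le3 le4 le5 le6.
have le8 : q * (c3 + (3 + h * (c5 + 5) + X) + 5) <=
    q * (134 * (h * h * n) + (s <= n) * (400 * (q * (n * s + l)))).
  by rewrite leq_mul2l; apply/orP; right; lia.
have e : q * (134 * (h * h * n) + (s <= n) * (400 * (q * (n * s + l)))) =
  134 * (q * (h * h * n)) + (s <= n) * (400 * (q * (q * (n * s + l)))) by ring.
have le9 : (s <= n) * (400 * (q * (q * (n * s + l)))) <=
           (s <= n) * (500 * (q * (q * (n * s + l)))).
  by rewrite leq_mul2l leq_mul2r orbT orbT.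
by lia.
Qed.

Lemma total_cost_ge :
  (s <= n) * (q * (h * h * n) + q * (q * (n * s + l)))
  + 5 * padding_count n s l <= total_cost n s l + 1.
Proof.
rewrite /total_cost /main_loop_cost /block_pass_cost.
case: (leqP s n) => [sn|_]; rewrite ?mul1n ?mul0n; last by lia.
have le1 : h * n <= panel_pass_cost n s + 5.
  rewrite /panel_pass_cost /fill2_cost; move: (store_cost _ _) => c; nia.
have le2 : q * (n * s + l) <= tensor_phase_cost n s l.
  rewrite /tensor_phase_cost /column_pass_cost; nia.
have le3 : h * (h * n) <= h * (panel_pass_cost n s + 5).
  by rewrite leq_mul2l le1 orbT.
have le4 : q * (h * h * n + q * (n * s + l)) <=
  q * (start_cost + (3 + h * (panel_pass_cost n s + 5)
       + (1 + tensor_phase_cost n s l)) + 5).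
  by rewrite leq_mul2l; apply/orP; right; rewrite -mulnA; lia.
rewrite mulnDr in le4.
by lia.
Qed.

(** For [s <= n] it follows from n <= q s: the panels give n^2 s^3, the tensor calls the other two
    terms. For n < s the padding loop alone is long enough. *)
Lemma scaled_bound_le : scaled_bound <= (total_cost n s l + 1) * s ^ 2.
Proof.
apply: leq_trans (leq_mul total_cost_ge (leqnn _)).
have /andP[le_b lt_b] := blocks_bounds n s_gt0.
rewrite /scaled_bound /padding_count; case: (leqP s n) => [sn|ns] /=.
  have -> : h = s by rewrite height_minn; lia.
  rewrite subnn mul0n mul1n muln0 addn0.
  have -> : (q * (s * s * n) + q * (q * (n * s + l))) * s ^ 2 =
    (q * s) * (n * s ^ 3) + (q * s) ^ 2 * (n * s + l) by ring.
  have le1 : n * (n * s ^ 3) <= q * s * (n * s ^ 3) by rewrite leq_mul2r le_b orbT.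
  have le2 : n ^ 2 * (n * s + l) <= (q * s) ^ 2 * (n * s + l).
    by rewrite leq_mul2r leq_exp2r // le_b orbT.
  have -> : n ^ 3 * s + n ^ 2 * l + n ^ 2 * s ^ 3 =
    n * (n * s ^ 3) + n ^ 2 * (n * s + l) by ring.
  exact: leq_add.
have ss0 : 0 < s * s by rewrite muln_gt0 s_gt0.
rewrite mul0n add0n subn0 mul1n.
(* The five units per padding iteration leave slack: n^2 s^3 also has to pay for n^3 s and for the
   at most s^2 lost in the rounded division. *)
have := ltn_ceil (n * n * l) ss0; move: (_ %/ _) => d le1.
have nns0 : 0 < n * n * s by rewrite !muln_gt0 n_gt0.
have le2 : n * n * s * n <= n * n * s * (s * s) by rewrite leq_mul2l; nia.
have le3 : s * s <= n * n * s * (s * s) by rewrite leq_pmull.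
have -> : n ^ 3 * s + n ^ 2 * l + n ^ 2 * s ^ 3 =
  n * n * s * n + n * n * l + n * n * s * (s * s) by ring.
have -> : 5 * (n * n * s + d) * s ^ 2 =
  5 * (n * n * s * (s * s)) + 5 * (d * (s * s)) by ring.
by rewrite mulSn in le1; lia.
Qed.

(** For [s <= n], q s < n + s <= 2 n, and 2000 is 500 times the square of 2. For n < s there is one
    block, whose n^3 is at most n^2 s. *)
Lemma le_scaled_bound : (total_cost n s l + 1) * s ^ 2 <= 2000 * scaled_bound.
Proof.
apply: leq_trans (leq_mul total_cost_le (leqnn _)) _.
have /andP[le_b lt_b] := blocks_bounds n s_gt0.
rewrite /scaled_bound /padding_count; case: (leqP s n) => [sn|ns] /=.
  have -> : h = s by rewrite height_minn; lia.
  rewrite subnn mul0n mul1n muln0 addn0.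
  have -> : (600 * (q * (s * s * n)) + 500 * (q * (q * (n * s + l)))) * s ^ 2 =
    600 * (q * s * (n * s ^ 3)) + 500 * ((q * s) ^ 2 * (n * s + l)) by ring.
  have le1 : q * s * (n * s ^ 3) <= 2 * n * (n * s ^ 3).
    by rewrite leq_mul2r; apply/orP; right; lia.
  have le2 : (q * s) ^ 2 * (n * s + l) <= (2 * n) ^ 2 * (n * s + l).
    by rewrite leq_mul2r leq_exp2r //; apply/orP; right; lia.
  have e1 : 2 * n * (n * s ^ 3) = 2 * (n ^ 2 * s ^ 3) by ring.
  have e2 : (2 * n) ^ 2 * (n * s + l) = 4 * (n ^ 3 * s) + 4 * (n ^ 2 * l) by ring.
  by lia.
have -> : h = n by rewrite height_minn; lia.
have -> : q = 1.
  by apply/eqP; rewrite eqn_leq blocks_gt0 andbT; move: lt_b ns; clear; nia.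
have ss0 : 0 < s * s by rewrite muln_gt0 s_gt0.
rewrite mul0n addn0 subn0 !mul1n.
have := leq_divM (n * n * l) (s * s); move: (_ %/ _) => d le1.
have le2 : n * n * n * (s * s) <= s * (n * n) * (s * s).
  by rewrite -[n * n * n]mulnA leq_mul2r leq_mul2r (ltnW ns) !orbT.
have -> : (600 * (n * n * n) + 5 * (n * n * s + d)) * s ^ 2 =
  600 * (n * n * n * (s * s)) + 5 * (s * (n * n) * (s * s)) + 5 * (d * (s * s))
  by ring.
have -> : n ^ 3 * s + n ^ 2 * l + n ^ 2 * s ^ 3 =
  n * n * n * s + n * n * l + s * (n * n) * (s * s) by ring.
by lia.
Qed.

End Bounds.

(** * The compiled program and the theorem *)

Definition closure_program : program := compile closure_cmd 0 ++ [:: Halt].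

Definition closure_time (n s l : nat) : nat := total_cost n s l + 1.

(** Origin of the exponent 4: with b = n + s^2 + l, the memory used, (n + s)^2, is at most b^2, and
    the padding count is at most n^2 (s + l) <= b^3. As b >= 2, one more factor b absorbs the lower
    order terms and gives strictness. *)
Lemma closure_program_run (w n s l : nat) (G : digraph n) :
  0 < n -> 0 < s -> (n + s ^ 2 + l) ^ 4 <= 2 ^ w ->
  exists st, run w s l closure_program (init s l G) (closure_time n s l) st /\
    read_mx (Defs.mem st) 0 n n = word_mx (transitive_closure G).
Proof.
move=> n0 s0 big.
have [sp1 sp2] : addrC n s + n * s + n + s + 1 < 2 ^ w /\
    n * n * s + n * n * l < 2 ^ w.
  have : (2 <= n + s ^ 2 + l /\ s <= s ^ 2)%N.
    by rewrite -mulnn; have := leq_pmulr s s0; lia.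
  move: big; rewrite /addrC /addrB /addrA.
  move: (s ^ 2)%N => m; set b := (n + m + l)%N => big [b2 sm].
  have bb : 2 * b <= b ^ 2 by rewrite -mulnn leq_mul2r b2 orbT.
  have bbb : 2 * b ^ 3 <= b ^ 4 by rewrite [b ^ 4]expnS leq_mul2r b2 orbT.
  have bbb' : 2 * b ^ 2 <= b ^ 3 by rewrite [b ^ 3]expnS leq_mul2r b2 orbT.
  have le1 : (n + s) * (n + s) <= b ^ 2 by rewrite -mulnn leq_mul // /b; lia.
  have le2 : n * n * (s + l) <= b ^ 3.
    by rewrite -[b ^ 3]/(b * (b * b)) mulnA leq_mul ?leq_mul // /b; lia.
  by split; nia.
have [||||r' [M' [ex HM]]] :=
  @closure_cmd_exec w n s l s0 n0 sp1 sp2 G (nth 0 [:: n; s; l])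
    (write_mx (fun=> 0) 0 (word_mx (adjacency_mx G))).
- by [].
- by [].
- by [].
- move=> i j ilt jlt.
  have := write_mx_cell (fun=> 0) 0 (word_mx (adjacency_mx G)) (Ordinal ilt) (Ordinal jlt).
  by rewrite add0n => /= ->; rewrite !mxE -lift_relE.
have [|||R' [st rep]] := @compile_correct w s l closure_program _ 0 (nth 0 [:: n; s; l]) _ _ _ _ _ ex.
- by move=> i ilt; rewrite add0n nth_cat ilt.
- by [].
- by [].
exists (State (0 + cmd_size closure_cmd) R' M'); split.
  apply: run_steps st _.
  (* The appended [Halt] is needed here: past the end of the program the machine is stuck but not
     [halted]. *)
  by rewrite /halted /closure_program onth_cat size_compile ltnn subnn.
by apply/matrixP => i j; rewrite !mxE add0n /= HM // lift_relE.
Qed.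

Lemma Theta_bound (n s l : nat) : (0 < s)%N ->
  (n%:R ^+ 3 / s%:R + n%:R ^+ 2 / (s ^ 2)%:R * l%:R + n%:R ^+ 2 * s%:R
   = (scaled_bound n s l)%:R / (s ^ 2)%:R :> rat)%R.
Proof.
move=> s0; have s_neq0 : (s%:R != 0 :> rat)%R by rewrite Num.Theory.pnatr_eq0 -lt0n.
rewrite /scaled_bound !(GRing.natrD, GRing.natrX, GRing.natrM).
by field.
Qed.

Lemma le_quotient_bounds (T g K m : nat) :
  0 < m -> g <= T * m -> T * m <= K * g ->
  (g%:R / m%:R <= T%:R :> rat /\ T%:R <= K%:R * (g%:R / m%:R) :> rat)%R.
Proof.
move=> m0 le1 le2; have m0' : (0 < m%:R :> rat)%R by rewrite Num.Theory.ltr0n.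
split; first by rewrite Num.Theory.ler_pdivrMr // -GRing.natrM Num.Theory.ler_nat.
by rewrite GRing.mulrA Num.Theory.ler_pdivlMr // -!GRing.natrM Num.Theory.ler_nat.
Qed.

Theorem theorem5 :
  exists (P : program) (k : nat) (T : nat -> nat -> nat -> nat),
    [/\ forall n s l w : nat, 0 < n -> 0 < s ->
          (n + s ^ 2 + l) ^ k <= 2 ^ w ->
          computes_transitive_closure w s l P n /\
          worst_case_time w s l P n (T n s l),
        Theta_on (fun n s l => 0 < n /\ 0 < s) T
          (fun n s l => n%:R ^+ 3 / s%:R
                        + n%:R ^+ 2 / (s ^ 2)%:R * l%:R
                        + n%:R ^+ 2 * s%:R)%R
      & Theta_on (fun n s l => [/\ 0 < n, 0 < s & s ^ 2 <= n]) T
          (fun n s l => n%:R ^+ 3 / s%:R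
                        + n%:R ^+ 2 / (s ^ 2)%:R * l%:R)%R].
Proof.
exists closure_program, 4, closure_time.
have [K K_gt0 bounds] : exists2 K : rat, (0 < K)%R & forall n s l,
    0 < n -> 0 < s ->
    let f := ((scaled_bound n s l)%:R / (s ^ 2)%:R)%R in
    (f <= (closure_time n s l)%:R)%R /\ ((closure_time n s l)%:R <= K * f)%R.
  exists 2000%:R%R; first by rewrite Num.Theory.ltr0n.
  move=> n s l n0 s0; apply: le_quotient_bounds.
  - by rewrite expn_gt0 s0.
  - exact: scaled_bound_le.
  - exact: le_scaled_bound.
split.
- move=> n s l w n0 s0 big; split=> [G|].
    by have [st [rn e]] := closure_program_run G n0 s0 big; exists (closure_time n s l), st.
  split=> [G t st rn|].
    by have [st' [/(run_det rn)[-> _] _]] := closure_program_run G n0 s0 big.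
  (* All graphs on n vertices cost the same, so any graph attains the maximum. *)
  pose G : digraph n := fun _ _ => false.
  by have [st [rn _]] := closure_program_run G n0 s0 big; exists G, st.
- exists 1%R, K; split=> // n s l [n0 s0].
  by rewrite GRing.mul1r Theta_bound //; apply: bounds.
exists 1%R, (K * 2)%R; split=> [//||n s l [n0 s0 ssn]].
  by rewrite Num.Theory.mulr_gt0.
have s0' : (0 < s%:R :> rat)%R by rewrite Num.Theory.ltr0n.
(* This is where s^2 <= n enters: the dropped term is at most the first one, so the upper constant
   merely doubles. *)
have ns_le : (n%:R ^+ 2 * s%:R <= n%:R ^+ 3 / s%:R :> rat)%R.
  rewrite Num.Theory.ler_pdivlMr // -GRing.mulrA -!GRing.natrX -!GRing.natrM.
  by rewrite Num.Theory.ler_nat [n ^ 3]expnSr leq_mul2l mulnn ssn orbT.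
have [] := bounds n s l n0 s0; rewrite -Theta_bound //.
set a := (n%:R ^+ 3 / s%:R)%R in ns_le *.
have : (0 <= n%:R ^+ 2 / (s ^ 2)%:R * l%:R :> rat)%R.
  by rewrite !Num.Theory.mulr_ge0 ?Num.Theory.invr_ge0 ?Num.Theory.exprn_ge0 ?Num.Theory.ler0n.
have : (0 <= n%:R ^+ 2 * s%:R :> rat)%R.
  by rewrite !Num.Theory.mulr_ge0 ?Num.Theory.exprn_ge0 ?Num.Theory.ler0n.
move: (_ * l%:R)%R (_ * s%:R)%R ns_le (closure_time n s l)%:R%R => b c ca t.
move=> c0 b0 lo up; split; first by lra.
apply: (Order.POrderTheory.le_trans up).
by rewrite -GRing.mulrA Num.Theory.ler_pM2l //; lra.
Qed.
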